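(* Let $V$ be a vector configuration of rank $r$ containing no copy of the zero vector, and suppose $\mathrm{DD}(V)\le 2$. Then $V$ admits a codegree$^*$ decomposition of length at least $r-\mathrm{DD}(V)$.
   Context: A vector configuration is a finite family (repetitions allowed) $V$ of vectors in $\mathbb{R}^r$; a subconfiguration is a subfamily, $\operatorname{rank}(V)=\dim\operatorname{lin}(V)$, and cardinalities count multiplicities. For a nonzero linear functional $f$, the oriented linear hyperplane $H=\{f=0\}$ has $\overline{H}^-=\{f\le0\}$. The dual codegree of a (sub)configuration $W$ is $\operatorname{codeg}^*(W)=\min_H|\overline{H}^-\cap W|$ over oriented linear hyperplanes $H$. The covector discrepancy is $\mathrm{DD}(W)=\max_f\big|\,|\{w\in W: f(w)>0\}|-|\{w\in W:f(w)<0\}|\,\big|$ over all linear functionals $f$. A codegree$^*$ decomposition of $V$ of length $m$ is a partition $V=V_0\uplus V_1\uplus\dots\uplus V_m$ into subconfigurations ($V_0$ possibly empty) such that $\operatorname{codeg}^*(V)=\sum_{i=1}^m\operatorname{codeg}^*(V_i)$ and $\operatorname{codeg}^*(V_i)\ge1$ for $1\le i\le m$. *)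

(* Defs.v *)
From HB Require Import structures.
From mathcomp Require Import all_boot all_order all_algebra.
From mathcomp Require Import boolp reals.
Set Implicit Arguments. Unset Strict Implicit. Unset Printing Implicit Defensive.
Import Order.TTheory GRing.Theory Num.Theory.
Local Open Scope ring_scope.

(* A vector configuration of N vectors (repetitions allowed) in R^n is a
   matrix V : 'M[R]_(N, n) whose rows are the vectors; it is indexed by 'I_N.
   A subconfiguration is a subset S : {set 'I_N}.
   A linear functional on R^n is f(w) = (w *m u) 0 0 for u : 'cV_n;
   it is nonzero iff u != 0. *)

Section Config.
Variables (R : realType) (N n : nat) (V : 'M[R]_(N, n)).

Definition fval (u : 'cV[R]_n) (i : 'I_N) : R := (row i V *m u) 0 0.

Definition nneg_count (S : {set 'I_N}) (u : 'cV[R]_n) : nat :=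
  #|[set i in S | fval u i <= 0]|.

(* codeg^*(S) = min over oriented linear hyperplanes (u != 0) of
   nneg_count S u.  (If n = 0 there is no hyperplane; convention 0.) *)
Definition codeg_star (S : {set 'I_N}) : nat :=
  match pselect (exists k, `[< exists u : 'cV[R]_n, u != 0 /\ nneg_count S u = k >]) with
  | left h => ex_minn h
  | right _ => 0%N
  end.

Definition pos_count (S : {set 'I_N}) (u : 'cV[R]_n) : nat :=
  #|[set i in S | 0 < fval u i]|.
Definition neg_count (S : {set 'I_N}) (u : 'cV[R]_n) : nat :=
  #|[set i in S | fval u i < 0]|.

Definition disc (S : {set 'I_N}) (u : 'cV[R]_n) : nat :=
  `|(pos_count S u)%:Z - (neg_count S u)%:Z|%N.

Definition DD_pred (S : {set 'I_N}) : pred nat :=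
  fun k => `[< exists u : 'cV[R]_n, disc S u = k >].

Lemma DD_ex (S : {set 'I_N}) : exists k, DD_pred S k.
Proof. by exists (disc S 0); apply/asboolP; exists 0. Qed.

Lemma DD_ub (S : {set 'I_N}) : forall k, DD_pred S k -> (k <= #|S|)%N.
Proof.
move=> k /asboolP [u <-]; rewrite /disc /pos_count /neg_count.
have Ha : (#|[set i in S | (0 < fval u i)%R]| <= #|S|)%N.
  by apply: subset_leq_card; apply/subsetP=> i; rewrite inE => /andP[].
have Hb : (#|[set i in S | (fval u i < 0)%R]| <= #|S|)%N.
  by apply: subset_leq_card; apply/subsetP=> i; rewrite inE => /andP[].
move: Ha Hb.
move: #|[set i in S | 0 < fval u i]| #|[set i in S | fval u i < 0]| => a b Ha Hb.
case: (leqP a b) => hab.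
  by rewrite (distnEr hab); apply: leq_trans (leq_subr a b) Hb.
by rewrite (distnEl (ltnW hab)); apply: leq_trans (leq_subr b a) Ha.
Qed.

Definition DD (S : {set 'I_N}) : nat := ex_maxn (DD_ex S) (@DD_ub S).

(* the subconfigurations V_1, ..., V_m of a partition given by
   c : 'I_N -> option 'I_m  (c i = None  <->  i in V_0) *)
Definition part (m : nat) (c : 'I_N -> option 'I_m) (j : 'I_m) : {set 'I_N} :=
  [set i | c i == Some j].

Definition codeg_decomposition (m : nat) (c : 'I_N -> option 'I_m) : Prop :=
  codeg_star setT = (\sum_(j < m) codeg_star (part c j))%N /\
  (forall j : 'I_m, (1 <= codeg_star (part c j))%N).

End Config.

(* Main.v *)
Require Import Defs.
From HB Require Import structures.
From mathcomp Require Import all_boot all_order all_algebra.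
From mathcomp Require Import zify ring lra.
From mathcomp Require Import boolp reals.
Set Implicit Arguments. Unset Strict Implicit. Unset Printing Implicit Defensive.
Import Order.TTheory GRing.Theory Num.Theory.
Local Open Scope ring_scope.

(* Functionals can be perturbed off all hyperplanes, whence 2 codeg*(S) + DD(S) = |S|
   for zero-free S.  Removing a pair {v, -cv}, c > 0, keeps DD, lowers codeg* by one
   and the rank by at most one, so one may assume that no such pair is left.  It
   remains to see that then the rank is at most DD + 1, or DD = 2 and S is the disjoint
   union of two rank-2 flats, each with an odd number of at least 3 points.

   Read S as a point set in projective space.  Perturbing a functional that vanishes on
   a flat F gives DD(F) + DD(S/F) <= DD(S).  All incidence arguments rest on one
   extremal principle for a contraction S/U with DD(S/U) <= D: if each point of S/U
   alone either has discrepancy D (is saturated) or cancels, then the saturated points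
   are collinear.  Indeed, let f vanish on two of them, p and q, but not on a third, and
   let u have opposite signs at p and q.  If t maximizes u/f among the saturated points
   with f <> 0, then the lines tp and tq prescribe opposite signs of f at t.
   - U = 0, D = 1: if DD(S) = 1, then S has rank at most 2.  For DD(S) = 2 it follows
     that planes have an even number of points.
   - U a point x occurring once, DD(S) = 2, D = 1: the even lines through x, namely
     those with an even number of points, are coplanar.
   - U = 0, D = 1, applied line by line: a set of points is collinear if any two of
     them span an odd line contained in it, since an odd line has discrepancy 1.
   Now let DD(S) = 2 and the rank be at least 4.  In a plane over an odd line l, some
   even line joins a point of l to a point z that lies on no odd line of the plane; all
   other points are joined by odd lines, so the plane is l together with z alone.
   Hence any two points off l span an odd line missing l, so all of them are collinear. *)

Section RowSpaces.
Variables (F : fieldType) (n : nat).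
Implicit Types (x y z : 'rV[F]_n).

Lemma submx_addsl m1 m2 m3 (A : 'M[F]_(m1, n)) (B : 'M_(m2, n)) (C : 'M_(m3, n)) :
  (A <= B)%MS -> (A <= B + C)%MS.
Proof. by move=> sAB; apply: submx_trans sAB (addsmxSl B C). Qed.

Lemma submx_addsr m1 m2 m3 (A : 'M[F]_(m1, n)) (B : 'M_(m2, n)) (C : 'M_(m3, n)) :
  (A <= C)%MS -> (A <= B + C)%MS.
Proof. by move=> sAC; apply: submx_trans sAC (addsmxSr B C). Qed.

Lemma addsmxAC m1 m2 m3 (A : 'M[F]_(m1, n)) (B : 'M_(m2, n)) (C : 'M_(m3, n)) :
  (A + B + C = A + C + B)%MS.
Proof. by rewrite -addsmxA [(B + C)%MS]addsmxC addsmxA. Qed.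

Lemma sub_adds_rVP m (A : 'M[F]_(m, n)) x y :
  reflect (exists c, (x - c *: y <= A)%MS) (x <= A + y)%MS.
Proof.
apply: (iffP sub_addsmxP) => [[[a b] /= ->]|[c /submxP[a xyA]]].
  by exists (b 0 0); rewrite {1}[b]mx11_scalar mul_scalar_mx addrK submxMl.
by exists (a, c%:M) => /=; rewrite -xyA mul_scalar_mx subrK.
Qed.

Lemma addsmx_exchange m (A : 'M[F]_(m, n)) x y :
  (x <= A + y)%MS -> ~~ (x <= A)%MS -> (y <= A + x)%MS.
Proof.
case/sub_adds_rVP=> c xyA nxA.
have c_neq0 : c != 0 by apply: contraNneq nxA => c0; rewrite c0 scale0r subr0 in xyA.
apply/sub_adds_rVP; exists c^-1.
have -> : y - c^-1 *: x = - c^-1 *: (x - c *: y).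
  by rewrite scalerBr !scaleNr scalerA mulVf // scale1r opprK addrC.
exact: scalemx_sub.
Qed.

Lemma addsmx_modular m p (A : 'M[F]_(m, n)) (B : 'M_(p, n)) x y :
  (A <= B)%MS -> (x <= A + y)%MS -> (x <= B)%MS -> ~~ (y <= B)%MS -> (x <= A)%MS.
Proof.
move=> sAB xAy xB; apply: contraNT => nxA.
by apply: submx_trans (addsmx_exchange xAy nxA) _; rewrite addsmx_sub sAB.
Qed.

Lemma sub_rVC x y : x != 0 -> y != 0 -> (x <= y)%MS = (y <= x)%MS.
Proof.
move=> x_neq0 y_neq0; have [+ +] : (\rank x = 1 /\ \rank y = 1)%N.
  by rewrite !rank_rV x_neq0 y_neq0.
by move=> rx ry; apply/idP/idP => /mxrank_leqif_sup[_ <-]; rewrite rx ry.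
Qed.

Lemma rank_adds_rV_le m (A : 'M[F]_(m, n)) x : (\rank (A + x)%MS <= (\rank A).+1)%N.
Proof.
apply: leq_trans (mxrank_adds_leqif A x) _.
by rewrite -[leqRHS]addn1 leq_add2l rank_leq_row.
Qed.

Lemma rank_adds_rV m (A : 'M[F]_(m, n)) x :
  ~~ (x <= A)%MS -> \rank (A + x)%MS = (\rank A).+1.
Proof.
move=> nxA; apply/eqP; rewrite eqn_leq rank_adds_rV_le /= rank_ltmx //.
by rewrite ltmxE addsmxSl addsmx_sub submx_refl.
Qed.

Lemma rank_line_le x y : (\rank (x + y)%MS <= 2)%N.
Proof. by apply: leq_trans (rank_adds_rV_le x y) _; rewrite ltnS rank_leq_row. Qed.

Lemma rank_plane_le x y z : (\rank (x + y + z)%MS <= 3)%N.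
Proof. by apply: leq_trans (rank_adds_rV_le (x + y)%MS z) _; rewrite ltnS rank_line_le. Qed.

Lemma rank_line x y : x != 0 -> ~~ (y <= x)%MS -> \rank (x + y)%MS = 2%N.
Proof. by move=> x_neq0 nyx; rewrite rank_adds_rV // rank_rV x_neq0. Qed.

Lemma rank_plane x y z :
  x != 0 -> ~~ (y <= x)%MS -> ~~ (z <= x + y)%MS -> \rank (x + y + z)%MS = 3%N.
Proof. by move=> x_neq0 nyx nz; rewrite rank_adds_rV // rank_line. Qed.

End RowSpaces.

Section LinearForms.
Variables (R : realFieldType) (n : nat).
Implicit Types (x y : 'rV[R]_n) (u f g : 'cV[R]_n) (c : R).

Definition lform u x : R := (x *m u) 0 0.

Lemma lform_is_scalar u : scalar (lform u).
Proof. by move=> c x y; rewrite /lform mulmxDl -scalemxAl !mxE. Qed.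

HB.instance Definition _ u :=
  GRing.isLinear.Build R 'rV[R]_n R *%R (lform u) (lform_is_scalar u).

Lemma lformD f g x : lform (f + g) x = lform f x + lform g x.
Proof. by rewrite /lform mulmxDr mxE. Qed.

Lemma lformZ c f x : lform (c *: f) x = c * lform f x.
Proof. by rewrite /lform -scalemxAr mxE. Qed.

Lemma lformN f x : lform (- f) x = - lform f x.
Proof. by rewrite /lform mulmxN mxE. Qed.

Lemma lform0 x : lform 0 x = 0.
Proof. by rewrite /lform mulmx0 mxE. Qed.

Lemma lform_eq0 u x : (lform u x == 0) = (x <= kermx u)%MS.
Proof.
apply/eqP/sub_kermxP => [xu0|xu0]; last by rewrite /lform xu0 mxE.
by apply/matrixP=> i j; rewrite !ord1 [RHS]mxE.
Qed.

Lemma sub_lform0 m (A : 'M[R]_(m, n)) u x :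
  (A <= kermx u)%MS -> (x <= A)%MS -> lform u x = 0.
Proof. by move=> Au xA; apply/eqP; rewrite lform_eq0; apply: submx_trans Au. Qed.

Lemma lform_congr m (A : 'M[R]_(m, n)) u x y c :
  (A <= kermx u)%MS -> (x - c *: y <= A)%MS -> lform u x = c * lform u y.
Proof.
by move=> Au /(sub_lform0 Au)/eqP; rewrite linearB scalarZ subr_eq0 => /eqP.
Qed.

Lemma sub_kermxDZ m (A : 'M[R]_(m, n)) f g c :
  (A <= kermx f)%MS -> (A <= kermx g)%MS -> (A <= kermx (f + c *: g))%MS.
Proof.
move=> /sub_kermxP Af /sub_kermxP Ag; apply/sub_kermxP.
by rewrite mulmxDr -scalemxAr Af Ag scaler0 addr0.
Qed.

Lemma sub_kermxN m (A : 'M[R]_(m, n)) f : (A <= kermx f)%MS -> (A <= kermx (- f))%MS.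
Proof. by move=> /sub_kermxP Af; apply/sub_kermxP; rewrite mulmxN Af oppr0. Qed.

Lemma sub_kermx0 m (A : 'M[R]_(m, n)) : (A <= kermx (0 : 'cV[R]_n))%MS.
Proof. by apply/sub_kermxP; rewrite mulmx0. Qed.

Lemma exists_separating_form m (A : 'M[R]_(m, n)) x :
  ~~ (x <= A)%MS -> exists2 u, (A <= kermx u)%MS & lform u x != 0.
Proof.
rewrite submxE => /matrix0Pn[i [j]]; rewrite ord1 => nz.
exists (col j (cokermx A)).
  by apply/sub_kermxP; rewrite colE mulmxA mulmx_coker mul0mx.
by rewrite /lform colE mulmxA -colE mxE.
Qed.

Lemma sgzD_small (a b : R) : `|b| < `|a| -> sgz (a + b) = sgz a.
Proof.
have [a_gt0|a_lt0|->] := ltrgt0P a; last by rewrite ltNge normr_ge0.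
  move=> ltba; rewrite !gtr0_sgz //; have := ler_norm (- b); rewrite normrN; lra.
by move=> ltba; rewrite !ltr0_sgz //; have := ler_norm b; lra.
Qed.

Lemma sgzD_opposite (a b : R) : a * b < 0 -> sgz a + sgz b = 0.
Proof.
move=> ab_lt0; have: sgz (a * b) = -1 by rewrite ltr0_sgz.
by rewrite sgzM; case: (sgzP a) => _; case: (sgzP b).
Qed.

Lemma exists_perturbation (I : finType) (x : I -> 'rV[R]_n) f g :
  exists2 e : R, 0 < e & forall i, sgz (lform (f + e *: g) (x i)) =
    if lform f (x i) == 0 then sgz (lform g (x i)) else sgz (lform f (x i)).
Proof.
pose ratio i := `|lform g (x i)| / `|lform f (x i)|.
have ratio_ge0 i : 0 <= ratio i by rewrite divr_ge0.
have bound_gt0 : 0 < 1 + \sum_i ratio i by rewrite ltr_pwDl // sumr_ge0.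
exists (1 + \sum_i ratio i)^-1 => [|i]; first by rewrite invr_gt0.
rewrite lformD lformZ; case: eqP => [->|/eqP fi_neq0].
  by rewrite add0r sgzM gtr0_sgz ?invr_gt0 // mul1r.
rewrite sgzD_small // normrM gtr0_norm ?invr_gt0 // mulrC ltr_pdivrMr //.
rewrite mulrC -ltr_pdivrMr ?normr_gt0 // (bigD1 i) //=.
by rewrite ltr_pwDl // lerDl sumr_ge0.
Qed.

Lemma exists_generic_form (I : finType) (x : I -> 'rV[R]_n) m (A : 'M[R]_(m, n)) :
  exists2 u, (A <= kermx u)%MS & forall i, ~~ (x i <= A)%MS -> lform u (x i) != 0.
Proof.
suff [u Au genu] : exists2 u, (A <= kermx u)%MS &
    forall i, i \in enum I -> ~~ (x i <= A)%MS -> lform u (x i) != 0.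
  by exists u => // i; apply: genu; rewrite mem_enum.
elim: (enum I) => [|j s [u Au genu]]; first by exists 0; rewrite ?sub_kermx0.
have [xjA|/exists_separating_form[g Ag gj]] := boolP (x j <= A)%MS.
  by exists u => // i; rewrite inE => /orP[/eqP->|]; [rewrite xjA | exact: genu].
have [e _ pert] := exists_perturbation x u g.
exists (u + e *: g) => [|i]; first exact: sub_kermxDZ.
rewrite inE -sgz_eq0 pert; case: ifPn => [ui0|ui_neq0 _ _]; last by rewrite sgz_eq0.
case/orP=> [/eqP-> _|i_s nxi]; first by rewrite sgz_eq0.
by rewrite (negbTE (genu i i_s nxi)) in ui0.
Qed.

End LinearForms.

Section SignSums.
Variables (R : realFieldType) (n : nat) (T : finType) (v : T -> 'rV[R]_n).
Implicit Types (S A : {set T}) (f g u h : 'cV[R]_n) (i : T) (D : nat).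

Definition sign_sum S u : int := \sum_(i in S) sgz (lform u (v i)).

Definition flat S m (A : 'M[R]_(m, n)) : {set T} := [set i in S | (v i <= A)%MS].

Definition sign_bounded S m (U : 'M[R]_(m, n)) D :=
  forall u, (U <= kermx u)%MS -> (`|sign_sum S u| <= D)%N.

Lemma sign_sumN S u : sign_sum S (- u) = - sign_sum S u.
Proof. by rewrite /sign_sum -sumrN; apply: eq_bigr => i _; rewrite lformN sgzN. Qed.

Lemma odd_sign_sum S u :
  odd `|sign_sum S u|%N = odd #|[set i in S | lform u (v i) != 0]|.
Proof.
have odd_absz : {morph (fun x : int => odd `|x|%N) : x y / x + y >-> x (+) y}.
  by move=> x y /=; lia.
rewrite /sign_sum (big_morph _ odd_absz (erefl _)) -sum1_card (big_morph _ oddD (erefl _)).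
rewrite [RHS](eq_bigl (fun i => (i \in S) && (lform u (v i) != 0))); last first.
  by move=> i; rewrite inE.
rewrite big_mkcondr; apply: eq_bigr => i _.
by rewrite sgz_def; case: (_ == _); case: (_ < _).
Qed.

Lemma in_flat S m (A : 'M[R]_(m, n)) i : (i \in flat S A) = (i \in S) && (v i <= A)%MS.
Proof. by rewrite inE. Qed.

Lemma flat_subset S m (A : 'M[R]_(m, n)) : flat S A \subset S.
Proof. by apply/subsetP=> i; rewrite in_flat => /andP[]. Qed.

Lemma flat_eqmx S m p (A : 'M[R]_(m, n)) (B : 'M[R]_(p, n)) :
  (A :=: B)%MS -> flat S A = flat S B.
Proof. by move=> eqAB; apply/setP=> i; rewrite !in_flat eqAB. Qed.

Lemma flat_flat S m p (A : 'M[R]_(m, n)) (B : 'M[R]_(p, n)) :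
  (A <= B)%MS -> flat (flat S B) A = flat S A.
Proof.
move=> sAB; apply/setP=> i; rewrite !in_flat -andbA.
by case: (boolP (v i <= A)%MS) => [/submx_trans->|]; rewrite ?andbF.
Qed.

Lemma flat_subset_id S A m (M : 'M[R]_(m, n)) :
  A \subset S -> flat S M \subset A -> flat A M = flat S M.
Proof.
move=> /subsetP sAS /subsetP sMA; apply/setP=> i; apply/idP/idP => [|iM].
  by rewrite !in_flat => /andP[/sAS->].
by rewrite in_flat sMA //; move: iM; rewrite in_flat => /andP[].
Qed.

Lemma sign_sum_flat S m (A : 'M[R]_(m, n)) u :
  sign_sum (flat S A) u = \sum_(i in S) if (v i <= A)%MS then sgz (lform u (v i)) else 0.
Proof. by rewrite -big_mkcondr; apply: eq_bigl => i; rewrite in_flat. Qed.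

(* If [f] kills the flat [F] and [f'] vanishes nowhere off [F], then for small
   positive [e2], [e1] the form [f + e2 (f' + e1 g)] has the sign of [g] on [F], and
   elsewhere that of [f], ties being broken by [f']; the signs of [f'] and [g]
   are free. *)
Lemma sign_bounded_contraction S m p (U : 'M[R]_(m, n)) (F : 'M[R]_(p, n)) D f g :
  sign_bounded S U D -> (U <= F)%MS -> (F <= kermx f)%MS -> (U <= kermx g)%MS ->
  (`|sign_sum S f| + `|sign_sum (flat S F) g| <= D)%N.
Proof.
move=> bS sUF Ff Ug; have [f' Ff' genf'] := exists_generic_form v F.
pose ties h : int := \sum_(i in S)
  if (lform f (v i) == 0) && ~~ (v i <= F)%MS then sgz (lform h (v i)) else 0.
have tiesN h : ties (- h) = - ties h.
  rewrite /ties -sumrN; apply: eq_bigr => i _; rewrite lformN sgzN.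
  by case: ifP => _; rewrite ?oppr0.
have bound h g' : (F <= kermx h)%MS -> (forall i, ~~ (v i <= F)%MS -> lform h (v i) != 0) ->
    (U <= kermx g')%MS -> (`|(sign_sum S f + sign_sum (flat S F) g' + ties h)%R| <= D)%N.
  move=> Fh genh Ug'; have [e1 _ pert1] := exists_perturbation v h g'.
  have [e2 _ pert2] := exists_perturbation v f (h + e1 *: g').
  suff -> : sign_sum S f + sign_sum (flat S F) g' + ties h =
      sign_sum S (f + e2 *: (h + e1 *: g')).
    apply: bS; apply: sub_kermxDZ (submx_trans sUF Ff) _.
    exact: sub_kermxDZ (submx_trans sUF Fh) Ug'.
  rewrite sign_sum_flat -!big_split; apply: eq_bigr => i _ /=; rewrite pert2 pert1.
  have [viF|nviF] := boolP (v i <= F)%MS.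
    by rewrite (sub_lform0 Ff viF) (sub_lform0 Fh viF) eqxx sgz0 add0r addr0.
  rewrite (negbTE (genh i nviF)) addr0; case: eqP => [->|_]; last by rewrite addr0.
  by rewrite sgz0 add0r.
have genNf' i : ~~ (v i <= F)%MS -> lform (- f') (v i) != 0.
  by move=> nviF; rewrite lformN oppr_eq0 genf'.
have := bound f' g Ff' genf' Ug; have := bound f' (- g) Ff' genf' (sub_kermxN Ug).
have := bound (- f') g (sub_kermxN Ff') genNf' Ug.
have := bound (- f') (- g) (sub_kermxN Ff') genNf' (sub_kermxN Ug).
rewrite !sign_sumN tiesN; lia.
Qed.

Lemma sign_bounded_flat S m p (U : 'M[R]_(m, n)) (F : 'M[R]_(p, n)) D :
  sign_bounded S U D -> (U <= F)%MS -> sign_bounded (flat S F) U D.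
Proof.
move=> bS sUF u Uu; apply: leq_trans (sign_bounded_contraction bS sUF (sub_kermx0 F) Uu).
exact: leq_addl.
Qed.

End SignSums.

Section ParallelClasses.
Variables (R : realFieldType) (n m : nat) (T : finType) (v : T -> 'rV[R]_n).
Variable U : 'M[R]_(m, n).
Implicit Types (S : {set T}) (f g u : 'cV[R]_n) (i j k : T).

Local Notation sign_sum := (sign_sum v).
Local Notation flat := (flat v).

Definition parallel_class S i : {set T} :=
  [set j in S | (v j <= U + v i)%MS && ~~ (v j <= U)%MS].

Lemma in_parallel_class S i j :
  (j \in parallel_class S i) = [&& j \in S, (v j <= U + v i)%MS & ~~ (v j <= U)%MS].
Proof. by rewrite inE. Qed.

Lemma parallel_class_refl S i : i \in S -> ~~ (v i <= U)%MS -> i \in parallel_class S i.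
Proof. by move=> iS iU; rewrite in_parallel_class iS addsmxSr. Qed.

Lemma eq_parallel_class S i j :
  j \in parallel_class S i -> parallel_class S j = parallel_class S i.
Proof.
rewrite in_parallel_class => /and3P[_ ji njU]; have ij := addsmx_exchange ji njU.
apply/setP=> k; rewrite !in_parallel_class.
suff -> : (v k <= U + v j)%MS = (v k <= U + v i)%MS by [].
by apply/idP/idP => kij; apply: submx_trans kij _; rewrite addsmx_sub addsmxSl.
Qed.

Lemma parallel_class_flat S p (F : 'M[R]_(p, n)) i :
  (U + v i <= F)%MS -> parallel_class (flat S F) i = parallel_class S i.
Proof.
move=> UiF; apply/setP=> j; rewrite !in_parallel_class in_flat -andbA.
by case: (boolP (v j <= U + v i)%MS) => [/submx_trans->|]; rewrite ?andbF.
Qed.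

Lemma sign_sum_parallel_class S i u :
  (U <= kermx u)%MS -> sign_sum (flat S (U + v i)%MS) u = sign_sum (parallel_class S i) u.
Proof.
move=> Uu; rewrite {1}/sign_sum (big_setID (flat S U)) /= big1 => [|j].
  rewrite add0r; apply: eq_bigl => j; rewrite in_setD !in_flat in_parallel_class.
  by case: (j \in S); rewrite //= andbC.
by rewrite in_setI !in_flat => /and3P[_ _ jU]; rewrite (sub_lform0 Uu jU) sgz0.
Qed.

Lemma sum_parallel_classes_eq0 S (X : {set T}) (G : T -> int) :
  (forall i, i \in X -> i \in parallel_class S i) ->
  (forall i, i \in X -> parallel_class S i \subset X) ->
  (forall i, i \in X -> \sum_(j in parallel_class S i) G j = 0) ->
  \sum_(i in X) G i = 0.
Proof.
move=> classX sub_classX sum0.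
rewrite (partition_big_imset (parallel_class S)) big1 //= => C.
case/imsetP=> i iX ->; rewrite -[RHS](sum0 i iX); apply: eq_bigl => j.
apply/andP/idP => [[jX /eqP <-]|ji]; first exact: classX.
by rewrite (subsetP (sub_classX i iX) _ ji) (eq_parallel_class ji).
Qed.

Lemma odd_sign_sum_parallel_class S i u : (U <= kermx u)%MS -> lform u (v i) != 0 ->
  odd `|sign_sum (parallel_class S i) u|%N = odd #|parallel_class S i|.
Proof.
move=> Uu ui; rewrite odd_sign_sum; congr (odd #|pred_of_set _|); apply/setP=> j.
rewrite inE andb_idr // in_parallel_class => /and3P[_ /sub_adds_rVP[c jci] njU].
rewrite (lform_congr Uu jci) mulf_neq0 //; apply: contraNneq njU => c0.
by rewrite c0 scale0r subr0 in jci.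
Qed.

Lemma eq_sign_sum_parallel_class S i f g :
  (U + v i <= kermx g)%MS ->
  sign_sum (parallel_class S i) (f + g) = sign_sum (parallel_class S i) f.
Proof.
move=> Uig; apply: eq_bigr => k; rewrite in_parallel_class => /and3P[_ ki _].
by rewrite lformD (sub_lform0 Uig ki) addr0.
Qed.

End ParallelClasses.

Section Saturation.
Variables (R : realFieldType) (n m : nat) (T : finType) (v : T -> 'rV[R]_n).
Variables (U : 'M[R]_(m, n)) (D : nat).
Hypothesis D_gt0 : (0 < D)%N.
Implicit Types (S : {set T}) (f g u w : 'cV[R]_n) (i j k l t : T).

Local Notation sign_sum := (sign_sum v).
Local Notation flat := (flat v).
Local Notation parallel_class := (parallel_class v U).

(* If [sign_bounded v S U D], then the class of a saturated point attains the bound. *)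
Definition saturated S i := forall u, (U <= kermx u)%MS -> lform u (v i) != 0 ->
  `|sign_sum (parallel_class S i) u|%N = D.

Definition balanced S i := forall u, (U <= kermx u)%MS ->
  sign_sum (parallel_class S i) u = 0.

Lemma exists_saturating_form S p (A : 'M[R]_(p, n)) i :
  (U <= A)%MS -> ~~ (v i <= A)%MS -> saturated S i ->
  exists u, [/\ (A <= kermx u)%MS, lform u (v i) != 0
    & sign_sum (parallel_class S i) u = D].
Proof.
move=> sUA /exists_separating_form[u Au ui] /(_ u (submx_trans sUA Au) ui).
case sumE: (sign_sum (parallel_class S i) u) => [d|d] /= dD.
  by exists u; rewrite sumE dD.
by exists (- u); rewrite sub_kermxN // lformN oppr_eq0 sign_sumN sumE NegzE opprK dD.
Qed.

Lemma exists_opposite_form S i j : ~~ (v i <= U)%MS -> ~~ (v j <= U + v i)%MS ->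
  saturated S i -> saturated S j -> exists u,
  [/\ (U <= kermx u)%MS, lform u (v i) != 0, lform u (v j) != 0,
      sign_sum (parallel_class S i) u = D & sign_sum (parallel_class S j) u = - D%:Z].
Proof.
move=> niU nji sati satj.
have nij : ~~ (v i <= U + v j)%MS.
  by apply: contraNN nji => ij; apply: addsmx_exchange ij niU.
have [a [Uja ai suma]] := exists_saturating_form (addsmxSl U (v j)) nij sati.
have [b [Uib bj sumb]] := exists_saturating_form (addsmxSl U (v i)) nji satj.
have Ub := sub_kermxN Uib.
exists (a - b); split.
- rewrite -scaleN1r; apply: sub_kermxDZ; first exact: submx_trans (addsmxSl _ _) Uja.
  exact: submx_trans (addsmxSl _ _) Uib.
- by rewrite lformD (sub_lform0 Ub (addsmxSr _ _)) addr0.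
- by rewrite addrC lformD (sub_lform0 Uja (addsmxSr _ _)) addr0 lformN oppr_eq0.
- by rewrite eq_sign_sum_parallel_class.
- by rewrite addrC eq_sign_sum_parallel_class // sign_sumN sumb.
Qed.

Lemma saturated_sign_sum_eq0 S i f : sign_bounded v S U D -> ~~ (v i <= U)%MS ->
  saturated S i -> (U + v i <= kermx f)%MS -> sign_sum S f = 0.
Proof.
move=> bS niU satS Uif.
have [g [Ug _ sumg]] := exists_saturating_form (submx_refl U) niU satS.
have := sign_bounded_contraction bS (addsmxSl U (v i)) Uif Ug.
by rewrite sign_sum_parallel_class // sumg; lia.
Qed.

Lemma sign_sum_parallel_class_eq0 S i f :
  (U + v i <= kermx f)%MS -> sign_sum (parallel_class S i) f = 0.
Proof.
move=> Uif; apply: big1 => k; rewrite in_parallel_class => /and3P[_ ki _].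
by rewrite (sub_lform0 Uif ki) sgz0.
Qed.

Definition line_rest S i t : {set T} :=
  [set l in flat S (U + v i + v t)%MS | ~~ (v l <= U + v i)%MS & ~~ (v l <= U + v t)%MS].

Lemma line_restP S i t l : reflect
  [/\ l \in S, (v l <= U + v i + v t)%MS, ~~ (v l <= U + v i)%MS & ~~ (v l <= U + v t)%MS]
  (l \in line_rest S i t).
Proof. by rewrite !inE -andbA; apply: and4P. Qed.

Lemma sign_sum_line S i t f : ~~ (v t <= U + v i)%MS -> (U <= kermx f)%MS ->
  sign_sum (flat S (U + v i + v t)%MS) f =
    sign_sum (parallel_class S i) f + sign_sum (parallel_class S t) f
      + sign_sum (line_rest S i t) f.
Proof.
move=> nti Uf; rewrite -(sign_sum_parallel_class v S i Uf).
rewrite -(sign_sum_parallel_class v S t Uf).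
have -> : sign_sum (line_rest S i t) f =
    \sum_(l in S) if l \in line_rest S i t then sgz (lform f (v l)) else 0.
  by rewrite -big_mkcondr; apply: eq_bigl => l; rewrite !inE; case: (l \in S).
rewrite !sign_sum_flat -!big_split; apply: eq_bigr => l lS /=; rewrite !inE lS /=.
have [li|nli] := boolP (v l <= U + v i)%MS; have [lt|nlt] := boolP (v l <= U + v t)%MS.
- have sUi := addsmxSl U (v i).
  by rewrite (sub_lform0 Uf (addsmx_modular sUi lt li nti)) sgz0 !if_same !addr0.
- by rewrite (submx_addsl _ li) !addr0.
- by rewrite andbF addr0 add0r (submx_trans lt) // addsmxS ?addsmxSl.
- by rewrite andbT !add0r; case: ifP.
Qed.

Lemma parallel_class_sub_line_rest S i t l :
  l \in line_rest S i t -> parallel_class S l \subset line_rest S i t.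
Proof.
case/line_restP=> _ lL nli nlt; apply/subsetP=> k.
rewrite in_parallel_class => /and3P[kS kl nkU].
have lk := addsmx_exchange kl nkU; apply/line_restP; split=> //.
- by apply: submx_trans kl _; rewrite addsmx_sub lL -addsmxA addsmxSl.
- by apply: contraNN nli => ki; apply: submx_trans lk _; rewrite addsmx_sub addsmxSl.
- by apply: contraNN nlt => kt; apply: submx_trans lk _; rewrite addsmx_sub addsmxSl.
Qed.

Lemma opposite_line_rest S i t f w : (U <= kermx f)%MS -> (U <= kermx w)%MS ->
  {in line_rest S i t, forall l, balanced S l \/ lform w (v l) * lform f (v l) < 0} ->
  sign_sum (line_rest S i t) w + sign_sum (line_rest S i t) f = 0.
Proof.
move=> Uf Uw opp; rewrite -big_split /=.
apply: (@sum_parallel_classes_eq0 _ _ _ _ v U S) => l lX.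
- have [lS _ nli _] := line_restP _ _ _ _ lX; apply: parallel_class_refl lS _.
  by apply: contraNN nli => /submx_addsl->.
- exact: parallel_class_sub_line_rest.
have [bal|wf_lt0] := opp l lX.
  by rewrite big_split /= [X in X + _]bal // [X in _ + X]bal // addr0.
apply: big1 => k; rewrite in_parallel_class => /and3P[_ /sub_adds_rVP[c kcl] _].
by rewrite (lform_congr Uw kcl) (lform_congr Uf kcl) !sgzM -mulrDr sgzD_opposite ?mulr0.
Qed.

Lemma extremal_line S i t f w :
    sign_bounded v (flat S (U + v i + v t)%MS) U D ->
    ~~ (v i <= U)%MS -> ~~ (v t <= U + v i)%MS -> saturated S i -> saturated S t ->
    (U + v i <= kermx f)%MS -> (U + v t <= kermx w)%MS ->
    lform f (v t) != 0 -> lform w (v i) != 0 ->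
    {in line_rest S i t, forall l, balanced S l \/ lform w (v l) * lform f (v l) < 0} ->
  sign_sum (parallel_class S t) f = - sign_sum (parallel_class S i) w.
Proof.
set L := flat _ _ => bL niU nti sati satt Uif Utw ft wi opp.
have Uf : (U <= kermx f)%MS by exact: submx_trans (addsmxSl _ _) Uif.
have Uw : (U <= kermx w)%MS by exact: submx_trans (addsmxSl _ _) Utw.
have Lf0 : sign_sum L f = 0.
  apply: saturated_sign_sum_eq0 bL niU _ Uif => u Uu ui.
  by rewrite parallel_class_flat ?addsmxSl // sati.
have := bL w Uw; move: Lf0; have := opposite_line_rest Uf Uw opp.
rewrite !sign_sum_line //.
rewrite (sign_sum_parallel_class_eq0 _ Utw) (sign_sum_parallel_class_eq0 _ Uif).
have := sati w Uw wi; have := satt f Uf ft; lia.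
Qed.

Lemma extremal_point S i t f u (ratio := fun l => lform u (v l) / lform f (v l)) :
    sign_bounded v (flat S (U + v i + v t)%MS) U D ->
    ~~ (v i <= U)%MS -> saturated S i -> saturated S t ->
    (U + v i <= kermx f)%MS -> (U <= kermx u)%MS ->
    lform f (v t) != 0 -> lform u (v i) != 0 ->
    (forall l, l \in S -> lform f (v l) != 0 ->
       balanced S l \/ ratio l <= ratio t) ->
  sign_sum (parallel_class S t) f = - sign_sum (parallel_class S i) u.
Proof.
move=> bL niU sati satt Uif Uu ft ui max_t.
have nti : ~~ (v t <= U + v i)%MS by apply: contraNN ft => /(sub_lform0 Uif)->.
have Uf : (U <= kermx f)%MS by exact: submx_trans (addsmxSl _ _) Uif.
pose w := u + (- ratio t) *: f.
have wE x : lform w x = lform u x - ratio t * lform f x by rewrite lformD lformZ mulNr.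
have Utw : (U + v t <= kermx w)%MS.
  by rewrite addsmx_sub sub_kermxDZ //= -lform_eq0 wE divfK // subrr.
have wi : lform w (v i) = lform u (v i).
  by rewrite wE (sub_lform0 Uif (addsmxSr _ _)) mulr0 subr0.
have <- : sign_sum (parallel_class S i) w = sign_sum (parallel_class S i) u.
  by apply: eq_sign_sum_parallel_class; rewrite -[_ *: f]add0r sub_kermxDZ ?sub_kermx0.
apply: (extremal_line bL niU nti sati satt Uif Utw ft); first by rewrite wi.
move=> l /line_restP[lS lL nli nlt].
have fl : lform f (v l) != 0.
  apply: contraNN nli; rewrite lform_eq0 => lf.
  by apply: (addsmx_modular Uif lL lf); rewrite -lform_eq0.
have lti : (v l <= U + v t + v i)%MS by rewrite addsmxAC.
have wl : lform w (v l) != 0.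
  apply: contraNN nlt; rewrite lform_eq0 => lw; apply: (addsmx_modular Utw lti lw).
  by rewrite -lform_eq0 wi.
have [bal|le_ratio] := max_t l lS fl; [by left | right].
rewrite lt_neqAle mulf_neq0 //=.
have -> : lform w (v l) * lform f (v l) = (ratio l - ratio t) * lform f (v l) ^+ 2.
  by rewrite wE /ratio; field; rewrite fl ft.
by rewrite pmulr_lle0 ?subr_le0 // exprn_even_gt0.
Qed.

(* Suppose [f] kills the line through [i] and [j] but not some saturated point.
   Take [u] with opposite class sums [D] at [i] and [- D] at [j], and let [t]
   maximize [u / f] among the saturated points off the kernel of [f].  Both lines
   from [t] to [i] and [j] then force the sign of [f] at [t], in opposite ways. *)
Theorem saturated_coplanar S i j k :
    k \in S -> saturated S i -> saturated S j -> saturated S k ->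
    ~~ (v i <= U)%MS -> ~~ (v j <= U + v i)%MS ->
    (forall l, l \in S -> ~~ (v l <= U + v i + v j)%MS ->
       [/\ saturated S l \/ balanced S l, sign_bounded v (flat S (U + v i + v l)%MS) U D
         & sign_bounded v (flat S (U + v j + v l)%MS) U D]) ->
  (v k <= U + v i + v j)%MS.
Proof.
move=> kS sati satj satk niU nji off; apply: contraT => /exists_separating_form[f ijf fk].
have [Uif Ujf] : (U + v i <= kermx f)%MS /\ (U + v j <= kermx f)%MS.
  split; apply: submx_trans ijf; first exact: addsmxSl.
  by rewrite addsmx_sub addsmxSr -addsmxA addsmxSl.
have offf l : lform f (v l) != 0 -> ~~ (v l <= U + v i + v j)%MS.
  by apply: contraNN => /(sub_lform0 ijf)->.
have njU : ~~ (v j <= U)%MS by apply: contraNN nji => /submx_addsl->.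
have [u [Uu ui uj sumi sumj]] := exists_opposite_form niU nji sati satj.
pose P l := [&& l \in S, lform f (v l) != 0 & `[< saturated S l >]].
have Pk : P k by rewrite /P kS fk asboolT.
have [t /and3P[tS ft /asboolP satt] max] :=
  arg_maxP (fun l => lform u (v l) / lform f (v l)) Pk.
have max_t l : l \in S -> lform f (v l) != 0 -> balanced S l \/
    lform u (v l) / lform f (v l) <= lform u (v t) / lform f (v t).
  move=> lS fl; have [[satl|ball] _ _] := off l lS (offf l fl); [right | by left].
  by apply: max; rewrite /P lS fl asboolT.
have [_ bi bj] := off t tS (offf t ft).
have := extremal_point bi niU sati satt Uif Uu ft ui max_t.
rewrite (extremal_point bj njU satj satt Ujf Uu ft uj max_t) sumi sumj.
by move: D_gt0; clear; lia.
Qed.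

End Saturation.

Section ConfigurationSpan.
Variables (R : realFieldType) (n : nat) (T : finType) (v : T -> 'rV[R]_n).
Implicit Types (S A B : {set T}) (i j k : T) (x y z : 'rV[R]_n).

Definition conf_span S : 'M[R]_n := (\sum_(i in S) <<v i>>)%MS.

Lemma sub_conf_spanP S m (M : 'M[R]_(m, n)) :
  reflect {in S, forall i, (v i <= M)%MS} (conf_span S <= M)%MS.
Proof. by apply: (iffP sumsmx_subP) => sub i iS; move: (sub i iS); rewrite genmxE. Qed.

Lemma mem_conf_span S i : i \in S -> (v i <= conf_span S)%MS.
Proof. exact/sub_conf_spanP. Qed.

Lemma exists_notin_conf_span S m (M : 'M[R]_(m, n)) :
  (\rank M < \rank (conf_span S))%N -> exists2 i, i \in S & ~~ (v i <= M)%MS.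
Proof.
move=> ltMS; apply/exists_inP; apply: contraTT ltMS.
rewrite negb_exists_in -leqNgt => /forall_inP sub.
by apply/mxrankS/sub_conf_spanP => i /sub; rewrite negbK.
Qed.

Lemma rank_conf_span_leD1 A B x :
  {in B, forall i, i \in A \/ (v i <= x)%MS} ->
  (\rank (conf_span B) <= (\rank (conf_span A)).+1)%N.
Proof.
move=> subB; apply: leq_trans (mxrankS _) (rank_adds_rV_le (conf_span A) x).
apply/sub_conf_spanP => i /subB[iA|ix]; last exact: submx_addsr.
exact: submx_addsl (mem_conf_span iA).
Qed.

Lemma rank_conf_span_le_card S : (\rank (conf_span S) <= #|S|)%N.
Proof.
have [c] := ubnP #|S|; elim: c S => // c IH S.
have [->|[i iS]] := set_0Vmem S; first by rewrite /conf_span big_set0 mxrank0.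
rewrite (cardsD1 i S) iS ltnS => /IH rankD1.
apply: (@leq_trans (\rank (conf_span (S :\ i))).+1); last by rewrite add1n ltnS.
apply: (rank_conf_span_leD1 (x := v i)) => j jS.
by rewrite !inE jS; case: eqP => [->|_]; [right | left].
Qed.

Lemma exists_notin_line S x y :
  (2 < \rank (conf_span S))%N -> exists2 i, i \in S & ~~ (v i <= x + y)%MS.
Proof. by move=> rk; apply/exists_notin_conf_span/(leq_ltn_trans (rank_line_le x y)). Qed.

Lemma exists_notin_plane S x y z :
  (3 < \rank (conf_span S))%N -> exists2 i, i \in S & ~~ (v i <= x + y + z)%MS.
Proof.
by move=> rk; apply/exists_notin_conf_span/(leq_ltn_trans (rank_plane_le x y z)).
Qed.

Lemma exists_independent3 S : (2 < \rank (conf_span S))%N -> exists i j k,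
  [/\ i \in S, j \in S, k \in S, ~~ (v j <= v i)%MS & ~~ (v k <= v i + v j)%MS].
Proof.
move=> rkS; have [i iS _] := exists_notin_line 0 0 rkS.
have [j jS] := exists_notin_line (v i) 0 rkS; rewrite addsmx0 => nji.
by have [k kS nk] := exists_notin_line (v i) (v j) rkS; exists i, j, k.
Qed.

Lemma flat_line S i j : i \in S -> j \in S ->
  i \in flat v S (v i + v j)%MS /\ j \in flat v S (v i + v j)%MS.
Proof. by move=> iS jS; rewrite !in_flat iS jS addsmxSl addsmxSr. Qed.

Lemma flat_plane S i j k (P := flat v S (v i + v j + v k)%MS) :
  i \in S -> j \in S -> k \in S -> [/\ i \in P, j \in P & k \in P].
Proof.
move=> iS jS kS; rewrite !in_flat iS jS kS addsmxSr.
by rewrite !(submx_addsl (v k)) ?addsmxSl ?addsmxSr.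
Qed.

End ConfigurationSpan.

Section AntipodalFree.
Variables (R : realFieldType) (n : nat) (T : finType) (v : T -> 'rV[R]_n).
Implicit Types (S A : {set T}) (f g u : 'cV[R]_n) (i j k l y : T) (D : nat).

Local Notation sign_sum := (sign_sum v).
Local Notation flat := (flat v).
Local Notation bounded S D := (sign_bounded v S (0 : 'M_n) D).
Local Notation conf_span := (conf_span v).

(* The scalar [c = 0] is covered, so zero vectors are excluded as well. *)
Definition antipodal_free S :=
  forall i j c, i \in S -> j \in S -> v j = c *: v i -> 0 < c.

Definition multiplicity S i := #|flat S (v i)|.

Lemma antipodal_free_neq0 S i : antipodal_free S -> i \in S -> v i != 0.
Proof.
move=> afS iS; apply/eqP => vi0.
by have := afS i i 0 iS iS; rewrite scale0r vi0 ltxx => /(_ erefl).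
Qed.

Lemma antipodal_freeS S A : A \subset S -> antipodal_free S -> antipodal_free A.
Proof. by move=> /subsetP sAS afS i j c iA jA; apply: afS; apply: sAS. Qed.

Lemma flat_point_refl S i : i \in S -> i \in flat S (v i).
Proof. by move=> iS; rewrite in_flat iS submx_refl. Qed.

Lemma multiplicity_gt0 S i : i \in S -> (0 < multiplicity S i)%N.
Proof. by move=> iS; apply/card_gt0P; exists i; apply: flat_point_refl. Qed.

Lemma multiplicity_flat S m (M : 'M[R]_(m, n)) i :
  (v i <= M)%MS -> multiplicity (flat S M) i = multiplicity S i.
Proof. by move=> iM; rewrite /multiplicity flat_flat. Qed.

Lemma multiplicity1P S i : i \in S ->
  reflect (flat S (v i) = [set i]) (multiplicity S i == 1%N).
Proof.
move=> iS; apply: (iffP cards1P) => [[j Fj]|->]; last by exists i.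
by have := flat_point_refl iS; rewrite Fj in_set1 => /eqP->.
Qed.

Lemma sign_sum_point S i u : antipodal_free S -> i \in S -> lform u (v i) != 0 ->
  `|sign_sum (flat S (v i)) u|%N = multiplicity S i.
Proof.
move=> afS iS ui; rewrite /sign_sum (eq_bigr (fun=> sgz (lform u (v i)))).
  rewrite sumr_const -mulr_natr abszM natz absz_nat sgz_def ui.
  by case: (_ < 0); rewrite mul1n.
move=> j; rewrite in_flat => /andP[jS /sub_rVP[c vj]].
by rewrite vj scalarZ sgzM (gtr0_sgz (afS _ _ _ iS jS vj)) mul1r.
Qed.

Lemma sign_sum_point_bound S D i f : antipodal_free S -> bounded S D -> i \in S ->
  (v i <= kermx f)%MS -> (`|sign_sum S f| + multiplicity S i <= D)%N.
Proof.
move=> afS bS iS fi.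
have [g _ gi] : exists2 g, ((0 : 'M_n) <= kermx g)%MS & lform g (v i) != 0.
  by apply: exists_separating_form; rewrite submx0 (antipodal_free_neq0 afS).
rewrite -(sign_sum_point afS iS gi).
exact: sign_bounded_contraction bS (sub0mx _ _) fi (sub0mx _ _).
Qed.

Lemma multiplicity_le S D i :
  antipodal_free S -> bounded S D -> i \in S -> (multiplicity S i <= D)%N.
Proof.
move=> afS bS iS; apply: leq_trans (sign_sum_point_bound afS bS iS (sub_kermx0 _)).
exact: leq_addl.
Qed.

Lemma bounded_flat S m (M : 'M[R]_(m, n)) D : bounded S D -> bounded (flat S M) D.
Proof. by move=> bS; apply: sign_bounded_flat bS (sub0mx _ _). Qed.

Lemma parallel_class0 S i :
  antipodal_free S -> parallel_class v (0 : 'M_n) S i = flat S (v i).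
Proof.
move=> afS; apply/setP=> j; rewrite in_parallel_class in_flat adds0mx submx0.
by case: (boolP (j \in S)) => //= jS; rewrite (antipodal_free_neq0 afS jS) andbT.
Qed.

Lemma equimultiple_collinear S D i j k :
    antipodal_free S -> (0 < D)%N -> i \in S -> j \in S -> k \in S ->
    multiplicity S i = D -> multiplicity S j = D -> ~~ (v j <= v i)%MS ->
    (forall l, l \in S -> ~~ (v l <= v i + v j)%MS ->
       [/\ multiplicity S l = D, bounded (flat S (v i + v l)%MS) D
         & bounded (flat S (v j + v l)%MS) D]) ->
  (v k <= v i + v j)%MS.
Proof.
move=> afS D_gt0 iS jS kS mi mj nji off; apply: contraT => nk.
have sat l : l \in S -> multiplicity S l = D -> saturated v (0 : 'M_n) D S l.
  by move=> lS <- u _ ul; rewrite parallel_class0 // sign_sum_point.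
have add0 x : ((0 : 'M_n) + v x :=: v x)%MS by apply: adds0mx.
have line0 x y : ((0 : 'M_n) + v x + v y :=: v x + v y)%MS by apply: adds_eqmx.
move/negP: (nk); case; rewrite -line0.
apply: (saturated_coplanar D_gt0 kS); rewrite ?add0 ?submx0 ?(antipodal_free_neq0 afS) //.
- exact: sat.
- exact: sat.
- by apply: sat => //; have [] := off k kS nk.
move=> l lS; rewrite line0 !(flat_eqmx _ _ (line0 _ _)) => /(off l lS)[ml bi bj].
by split=> //; left; apply: sat.
Qed.

Lemma rank_conf_span_bounded1 S :
  antipodal_free S -> bounded S 1 -> (\rank (conf_span S) <= 2)%N.
Proof.
move=> afS bS; rewrite leqNgt; apply/negP => /exists_independent3[i [j [k [iS jS kS nji]]]].
have mult1 l : l \in S -> multiplicity S l = 1%N.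
  by move=> lS; apply/eqP; rewrite eqn_leq multiplicity_gt0 // (multiplicity_le afS bS).
case/negP.
apply: (equimultiple_collinear afS _ iS jS kS (mult1 i iS) (mult1 j jS) nji) => //.
by move=> l lS _; split; [exact: mult1 | exact: bounded_flat | exact: bounded_flat].
Qed.

Lemma exists_simple_point S :
  antipodal_free S -> bounded S 2 -> (2 < \rank (conf_span S))%N ->
  exists2 i, i \in S & multiplicity S i == 1%N.
Proof.
move=> afS bS /exists_independent3[i [j [k [iS jS kS nji]]]] nkij.
apply/exists_inP; apply: contraNT nkij; rewrite negb_exists_in => /forall_inP not_simple.
have mult2 l : l \in S -> multiplicity S l = 2%N.
  move=> lS; apply/eqP; rewrite eqn_leq (multiplicity_le afS bS) //.
  by rewrite ltn_neqAle multiplicity_gt0 // eq_sym not_simple.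
apply: (equimultiple_collinear afS _ iS jS kS (mult2 i iS) (mult2 j jS) nji) => // l lS _.
by split; [exact: mult2 | exact: bounded_flat | exact: bounded_flat].
Qed.

Lemma odd_bounded1 S : antipodal_free S -> bounded S 2 -> odd #|S| -> bounded S 1.
Proof.
move=> afS bS oddS u _; have [g _ gen_g] := exists_generic_form v (0 : 'M[R]_n).
have S_neq0 i : i \in S -> lform g (v i) != 0.
  by move=> iS; rewrite gen_g // submx0 (antipodal_free_neq0 afS).
have := sign_bounded_contraction bS (sub0mx n (kermx u)) (submx_refl _)
  (sub0mx n (kermx g)).
have := odd_sign_sum v (flat S (kermx u)) g; have := odd_sign_sum v S u.
have -> : [set i in flat S (kermx u) | lform g (v i) != 0] = flat S (kermx u).
  by apply/setP=> i; rewrite inE andb_idr // in_flat => /andP[/S_neq0].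
have -> : [set i in S | lform u (v i) != 0] = S :\: flat S (kermx u).
  by apply/setP=> i; rewrite !inE lform_eq0; case: (i \in S); rewrite ?andbF ?andbT.
have := subset_leq_card (flat_subset v S (kermx u)).
rewrite cardsDS ?flat_subset //; move: oddS; clear; lia.
Qed.

Lemma rank_conf_span_odd S :
  antipodal_free S -> bounded S 2 -> odd #|S| -> (\rank (conf_span S) <= 2)%N.
Proof.
by move=> afS bS oddS; apply: rank_conf_span_bounded1 => //; apply: odd_bounded1.
Qed.

Lemma odd_flat_simple S m (M : 'M[R]_(m, n)) i : antipodal_free S -> bounded S 2 ->
  odd #|flat S M| -> i \in flat S M -> multiplicity S i = 1%N.
Proof.
move=> afS bS oddM iM; have afM := antipodal_freeS (flat_subset v S M) afS.
have := multiplicity_le afM (odd_bounded1 afM (bounded_flat M bS) oddM) iM.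
have := multiplicity_gt0 iM; rewrite !multiplicity_flat; first by lia.
by move: iM; rewrite in_flat => /andP[].
Qed.

Lemma odd_lines_collinear S A i j : antipodal_free S -> bounded S 2 -> A \subset S ->
    i \in A -> j \in A -> ~~ (v j <= v i)%MS ->
    (forall y l, y \in [set i; j] -> l \in A -> ~~ (v l <= v i + v j)%MS ->
       odd #|flat S (v y + v l)%MS| /\ flat S (v y + v l)%MS \subset A) ->
  (conf_span A <= v i + v j)%MS.
Proof.
move=> afS bS sAS iA jA nji odd_lines; apply/sub_conf_spanP => k kA; apply: contraT => nk.
have lineA y l : y \in [set i; j] -> l \in A -> ~~ (v l <= v i + v j)%MS ->
    odd #|flat S (v y + v l)%MS| /\ flat A (v y + v l)%MS = flat S (v y + v l)%MS.
  move=> yij lA nl; have [oddL sLA] := odd_lines y l yij lA nl.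
  by rewrite (flat_subset_id sAS).
have mult1 y l : y \in [set i; j] -> l \in A -> ~~ (v l <= v i + v j)%MS ->
    multiplicity A y = 1%N /\ multiplicity A l = 1%N.
  move=> yij lA nl; have [oddL eqL] := lineA y l yij lA nl.
  have yA : y \in A by move: yij; rewrite !inE => /orP[]/eqP->.
  have [yL lL] := flat_line v yA lA.
  have mA x : x \in flat A (v y + v l)%MS -> multiplicity A x = 1%N.
    move=> xL; have xM : (v x <= v y + v l)%MS by move: xL; rewrite in_flat => /andP[].
    rewrite -(multiplicity_flat A xM) eqL multiplicity_flat //.
    by apply: odd_flat_simple afS bS oddL _; rewrite -eqL.
  by rewrite !mA.
have [mi _] := mult1 i k (set21 i j) kA nk; have [mj _] := mult1 j k (set22 i j) kA nk.
move/negP: (nk); case.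
have afA := antipodal_freeS sAS afS.
apply: (equimultiple_collinear afA _ iA jA kA mi mj nji) => // l lA nl.
have bline y : y \in [set i; j] -> bounded (flat A (v y + v l)%MS) 1.
  move=> yij; have [oddL ->] := lineA y l yij lA nl.
  apply: odd_bounded1 oddL; last exact: bounded_flat.
  exact: antipodal_freeS (flat_subset _ _ _) afS.
have [_ ml] := mult1 i l (set21 i j) lA nl.
by split; [exact: ml | exact: bline (set21 i j) | exact: bline (set22 i j)].
Qed.

End AntipodalFree.

Section EvenLines.
Variables (R : realFieldType) (n : nat) (T : finType) (v : T -> 'rV[R]_n).
Variable S : {set T}.
Hypotheses (afS : antipodal_free v S) (bS : sign_bounded v S (0 : 'M_n) 2).
Implicit Types (u f : 'cV[R]_n) (i j k l : T).

Local Notation flat := (flat v).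
Local Notation simple i := (multiplicity v S i == 1%N).

Definition even_line i j := ~~ odd #|flat S (v i + v j)%MS|.

Lemma even_lineC i j : even_line i j = even_line j i.
Proof. by rewrite /even_line addsmxC. Qed.

Lemma even_line_eq i j k : (v k <= v i + v j)%MS -> ~~ (v k <= v i)%MS ->
  even_line i k = even_line i j.
Proof.
move=> kij nki; rewrite /even_line; congr (~~ odd #|pred_of_set _|); apply: flat_eqmx.
by apply/eqmxP; rewrite !addsmx_sub !addsmxSl kij (addsmx_exchange kij nki).
Qed.

Lemma parallelC i j : i \in S -> j \in S -> (v i <= v j)%MS = (v j <= v i)%MS.
Proof. by move=> iS jS; rewrite sub_rVC ?(antipodal_free_neq0 afS). Qed.

Lemma simple_parallel i j : simple i -> i \in S -> j \in S -> (v j <= v i)%MS -> j = i.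
Proof.
by move=> si iS jS ji; apply/set1P; rewrite -((multiplicity1P v iS) si) in_flat jS.
Qed.

Lemma simple_bounded1 i : i \in S -> simple i -> sign_bounded v S (v i) 1.
Proof.
by move=> iS /eqP si u iu; have := sign_sum_point_bound afS bS iS iu; rewrite si addn1.
Qed.

Lemma card_line i j :
  #|flat S (v i + v j)%MS| = (multiplicity v S i + #|parallel_class v (v i) S j|)%N.
Proof.
have sub : flat S (v i) \subset flat S (v i + v j)%MS.
  by apply/subsetP=> k; rewrite !in_flat => /andP[-> /submx_addsl->].
rewrite -(cardsID (flat S (v i))) (setIidPr sub); congr (_ + _)%N; apply: eq_card => k.
by rewrite in_setD !in_flat in_parallel_class; case: (k \in S); rewrite //= andbC.
Qed.

Lemma odd_parallel_class i j :
  simple i -> odd #|parallel_class v (v i) S j| = even_line i j.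
Proof. by move=> /eqP si; rewrite /even_line card_line si add1n /= negbK. Qed.

Lemma sign_sum_parallel_class_le1 i l u : i \in S -> simple i -> (v i <= kermx u)%MS ->
  (`|sign_sum v (parallel_class v (v i) S l) u| <= 1)%N.
Proof.
move=> iS si iu; rewrite -sign_sum_parallel_class //.
exact: sign_bounded_flat (simple_bounded1 iS si) (addsmxSl _ _) u iu.
Qed.

Lemma even_line_saturated i l : i \in S -> simple i -> even_line i l ->
  saturated v (v i) 1 S l.
Proof.
move=> iS si; rewrite -odd_parallel_class // => odd_l u iu ul.
have := sign_sum_parallel_class_le1 l iS si iu; have := odd_sign_sum_parallel_class S iu ul.
by rewrite odd_l; case: absz => [|[]].
Qed.

Lemma odd_line_balanced i l : i \in S -> simple i -> ~~ even_line i l ->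
  balanced v (v i) S l.
Proof.
move=> iS si; rewrite -odd_parallel_class // => even_l u iu.
have [ul0|ul] := eqVneq (lform u (v l)) 0.
  by apply: sign_sum_parallel_class_eq0; rewrite addsmx_sub iu -lform_eq0 ul0 eqxx.
have := sign_sum_parallel_class_le1 l iS si iu; have := odd_sign_sum_parallel_class S iu ul.
rewrite (negbTE even_l) => even_sum sum_le1; apply/eqP; rewrite -absz_eq0.
by case: absz even_sum sum_le1 => [|[]].
Qed.

Lemma even_lines_coplanar i j k l : i \in S -> simple i -> l \in S ->
  ~~ (v j <= v i)%MS -> ~~ (v k <= v i + v j)%MS ->
  even_line i j -> even_line i k -> even_line i l -> (v l <= v i + v j + v k)%MS.
Proof.
move=> iS si lS nji nkij ej ek el; have b1 := simple_bounded1 iS si.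
have sat x : even_line i x -> saturated v (v i) 1 S x by apply: even_line_saturated.
apply: (saturated_coplanar (ltnSn 0) lS (sat j ej) (sat k ek) (sat l el) nji nkij).
move=> x xS _.
have b1_plane y z : sign_bounded v (flat S (v i + v y + v z)%MS) (v i) 1.
  exact: sign_bounded_flat b1 (submx_addsl _ (addsmxSl _ _)).
split; try exact: b1_plane.
have [ex|ox] := boolP (even_line i x); [left; exact: sat | right].
exact: odd_line_balanced.
Qed.

Lemma exists_even_line i : i \in S -> simple i -> ~~ odd #|S| ->
  exists2 j, j \in S & ~~ (v j <= v i)%MS /\ even_line i j.
Proof.
move=> iS si evenS; have [f fi gen_f] := exists_generic_form v (v i).
suff /exists_inP[j jS /andP[]] : [exists j in S, ~~ (v j <= v i)%MS && even_line i j].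
  by exists j.
apply: contraT; rewrite negb_exists_in => /forall_inP all_odd.
have offi j : j \in S :\ i -> j \in S /\ ~~ (v j <= v i)%MS.
  rewrite in_setD1 => /andP[neq_ji jS]; split=> //.
  by apply: contraNN neq_ji => ji; apply/eqP; apply: simple_parallel ji.
have fi0 : lform f (v i) = 0 by apply/eqP; rewrite lform_eq0.
have sum0 : sign_sum v S f = 0.
  rewrite /sign_sum (big_setD1 i iS) /= fi0 sgz0 add0r.
  apply: (@sum_parallel_classes_eq0 _ _ _ _ v (v i) S) => j /offi[jS nji].
  - exact: parallel_class_refl.
  - apply/subsetP=> k; rewrite in_parallel_class in_setD1 => /and3P[-> _ nki].
    by rewrite andbT; apply: contraNneq nki => ->.
  - by apply: odd_line_balanced => //; have := all_odd j jS; rewrite nji.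
have := odd_sign_sum v S f; rewrite sum0.
have -> : [set j in S | lform f (v j) != 0] = S :\ i.
  apply/setP=> j; rewrite inE andbC.
  apply/andP/idP => [[fj jS]|/[dup] /offi[jS nji] _]; last by split; first exact: gen_f.
  by rewrite in_setD1 jS andbT; apply: contraNneq fj => ->; apply/eqP.
by move: evenS; rewrite (cardsD1 i S) iS /= negbK => ->.
Qed.

End EvenLines.

Lemma even_line_flat (R : realFieldType) n (T : finType) (v : T -> 'rV[R]_n) (S : {set T})
    m (M : 'M[R]_(m, n)) i j :
  (v i <= M)%MS -> (v j <= M)%MS -> even_line v (flat v S M) i j = even_line v S i j.
Proof. by move=> iM jM; rewrite /even_line flat_flat // addsmx_sub iM. Qed.

Section TwoOddLines.
Variables (R : realFieldType) (n : nat) (T : finType) (v : T -> 'rV[R]_n).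
Variable S : {set T}.
Hypotheses (afS : antipodal_free v S) (bS : sign_bounded v S (0 : 'M_n) 2).
Hypothesis rank_gt3 : (3 < \rank (conf_span v S))%N.
Implicit Types (a b i j k l w x y z : T).

Local Notation flat := (flat v).
Local Notation conf_span := (conf_span v).
Local Notation simple i := (multiplicity v S i == 1%N).
Local Notation even_line := (even_line v S).
Local Notation parC := (parallelC afS).

Lemma odd_line_simple i j : i \in S -> ~~ even_line i j -> simple i.
Proof.
move=> iS; rewrite negbK => oddij; apply/eqP; apply: odd_flat_simple oddij _ => //.
by rewrite in_flat iS addsmxSl.
Qed.

Lemma rank_conf_span_plane i j k : i \in S -> j \in S -> k \in S ->
  ~~ (v j <= v i)%MS -> ~~ (v k <= v i + v j)%MS ->
  (2 < \rank (conf_span (flat S (v i + v j + v k)%MS)))%N.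
Proof.
move=> iS jS kS nji nkij; have [iP jP kP] := flat_plane v iS jS kS.
rewrite -(rank_plane (antipodal_free_neq0 afS iS) nji nkij); apply: mxrankS.
by rewrite !addsmx_sub !mem_conf_span.
Qed.

Lemma exists_even_line_in_flat m (M : 'M[R]_(m, n)) x :
  (2 < \rank (conf_span (flat S M)))%N -> x \in flat S M -> simple x ->
  exists2 l, l \in flat S M & ~~ (v l <= v x)%MS /\ even_line x l.
Proof.
move=> rkM xM sx; have afM := antipodal_freeS (flat_subset v S M) afS.
have bM := bounded_flat M bS.
have inM l : l \in flat S M -> (v l <= M)%MS by rewrite in_flat => /andP[].
have evenM : ~~ odd #|flat S M|.
  by apply: contraTN rkM => /(rank_conf_span_odd afM bM); rewrite -leqNgt.
have sxM : multiplicity v (flat S M) x == 1%N by rewrite multiplicity_flat ?inM.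
have [l lM [nlx exl]] := exists_even_line afM bM xM sxM evenM.
by exists l => //; rewrite -(even_line_flat S (inM x xM) (inM l lM)).
Qed.

(* An odd line [xl] of the plane would span with a point [g] off the plane a second
   plane, containing another even line [xm]; as all even lines through [x] are
   coplanar, [m] lies in both planes, hence on [xl]. *)
Lemma even_pencil x a b l : x \in S -> l \in S -> simple x ->
  ~~ (v a <= v x)%MS -> ~~ (v b <= v x + v a)%MS -> even_line x a -> even_line x b ->
  ~~ (v l <= v x)%MS -> (v l <= v x + v a + v b)%MS -> even_line x l.
Proof.
move=> xS lS sx nax nbxa exa exb nlx lM.
have [g gS ngM] := exists_notin_plane (v x) (v a) (v b) rank_gt3.
have sub_xl : (v x + v l <= v x + v a + v b)%MS.
  by rewrite addsmx_sub lM -addsmxA addsmxSl.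
have ngxl : ~~ (v g <= v x + v l)%MS.
  by apply: contraNN ngM => gxl; apply: submx_trans gxl sub_xl.
have [xN _ _] := flat_plane v xS lS gS.
have [m] := exists_even_line_in_flat (rank_conf_span_plane xS lS gS nlx ngxl) xN sx.
rewrite in_flat => /andP[mS mN] [noddx exm].
have mM := even_lines_coplanar afS bS xS sx mS nax nbxa exa exb exm.
have mxl := addsmx_modular sub_xl mN mM ngM.
by rewrite -(even_line_eq S mxl noddx).
Qed.

Section Plane.
Variables (M : 'M[R]_n).
Local Notation P := (flat S M).
Hypotheses (rank_M : \rank M = 3%N) (span_P : (M <= conf_span P)%MS).

Let inS i : i \in P -> i \in S.
Proof. by rewrite in_flat => /andP[]. Qed.

Let inM i : i \in P -> (v i <= M)%MS.
Proof. by rewrite in_flat => /andP[]. Qed.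

Lemma exists_off_line x y : exists2 l, l \in P & ~~ (v l <= v x + v y)%MS.
Proof. by apply: exists_notin_line; rewrite -rank_M mxrankS. Qed.

Definition on_odd_line x := [exists a in P, ~~ (v a <= v x)%MS && ~~ even_line x a].

Lemma on_odd_lineP x : reflect
  (exists2 a, a \in P & ~~ (v a <= v x)%MS /\ ~~ even_line x a) (on_odd_line x).
Proof. by apply: (iffP exists_inP) => -[a aP /andP]; exists a. Qed.

Lemma not_on_odd_line_even x a :
  ~~ on_odd_line x -> a \in P -> ~~ (v a <= v x)%MS -> even_line x a.
Proof.
by move=> noddx aP nax; apply: contraR noddx => oxa; apply/on_odd_lineP; exists a.
Qed.

Lemma on_odd_line_simple x : x \in P -> on_odd_line x -> simple x.
Proof. by move=> /inS xS /on_odd_lineP[a _ [_]]; apply: odd_line_simple. Qed.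

Lemma on_odd_line_even_line_unique x y l : on_odd_line x -> x \in P -> y \in P -> l \in P ->
  ~~ (v y <= v x)%MS -> ~~ (v l <= v x)%MS ->
  even_line x y -> even_line x l -> (v l <= v x + v y)%MS.
Proof.
move=> oddx xP yP lP nyx nlx exy exl; have sx := on_odd_line_simple xP oddx.
have [a aP [nax oxa]] := on_odd_lineP x oddx; apply: contraR oxa => nlxy.
have rank_xyl := rank_plane (antipodal_free_neq0 afS (inS xP)) nyx nlxy.
have sub : (v x + v y + v l <= M)%MS by rewrite !addsmx_sub !inM.
have sub_M : (M <= v x + v y + v l)%MS by rewrite -(mxrank_leqif_sup sub) rank_xyl rank_M.
apply: (even_pencil (inS xP) (inS aP) sx nyx nlxy exy exl nax).
exact: submx_trans (inM aP) sub_M.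
Qed.

Lemma odd_lines_off_even_line x y l : on_odd_line x -> x \in P -> y \in P -> l \in P ->
  ~~ (v y <= v x)%MS -> even_line x y -> ~~ (v l <= v x + v y)%MS ->
  ~~ even_line x l /\
  flat S (v x + v l)%MS \subset x |: [set k in P | ~~ (v k <= v x + v y)%MS].
Proof.
move=> oddx xP yP lP nyx exy nlxy.
have nlx : ~~ (v l <= v x)%MS by apply: contraNN nlxy => /submx_addsl->.
split; first by apply: contraNN nlxy; apply: on_odd_line_even_line_unique exy.
apply/subsetP=> k; rewrite in_flat => /andP[kS kxl]; rewrite !inE kS.
rewrite (submx_trans kxl) ?addsmx_sub ?inM //=.
have [kxy|_] := boolP (v k <= v x + v y)%MS; last by rewrite orbT.
rewrite (simple_parallel (on_odd_line_simple xP oddx) (inS xP) kS) ?eqxx //.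
exact: addsmx_modular (addsmxSl _ _) kxl kxy nlxy.
Qed.

(* Otherwise the line through [x] and [y] would be the only even line of the plane
   through either point, and all lines from these two to points off it would be odd. *)
Lemma even_neighbour_not_on_odd_line x y : on_odd_line x -> x \in P -> y \in P ->
  ~~ (v y <= v x)%MS -> even_line x y -> ~~ on_odd_line y.
Proof.
move=> oddx xP yP nyx exy; apply/negP => oddy.
have nxy : ~~ (v x <= v y)%MS by rewrite parC ?inS.
have eyx : even_line y x by rewrite even_lineC.
pose A := [set x; y] :|: [set k in P | ~~ (v k <= v x + v y)%MS].
have sAP : A \subset P.
  by rewrite !subUset !sub1set xP yP; apply/subsetP=> k; rewrite inE => /andP[].
have sAS := subset_trans sAP (flat_subset v S M).
have [xA yA] : x \in A /\ y \in A by rewrite !inE !eqxx orbT.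
have [l lP] := exists_off_line x y; move/negP; apply.
suff /sub_conf_spanP sub : (conf_span A <= v x + v y)%MS.
  by apply: contraT => nl; case/negP: (nl); apply: sub; rewrite inE inE lP nl orbT.
apply: (odd_lines_collinear afS bS sAS xA yA nyx) => z k.
rewrite in_set2 => zxy kA nk; have kP := subsetP sAP k kA.
have xyE := addsmxC (v x) (v y).
have subA c : c \in [set x; y] -> c |: [set k in P | ~~ (v k <= v x + v y)%MS] \subset A.
  by move=> cxy; apply: setSU; rewrite sub1set.
case/orP: zxy => /eqP->.
  have [] := odd_lines_off_even_line oddx xP yP kP nyx exy nk.
  by rewrite negbK => oxk /subset_trans-> //; apply: subA; rewrite set21.
have [] := odd_lines_off_even_line oddy yP xP kP nxy eyx _; rewrite -xyE // negbK => oyk.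
by move=> /subset_trans-> //; apply: subA; rewrite set22.
Qed.

(* In the end, [z] turns out to be the only point of the plane off the odd line [ij]. *)
Variables (i j z : T).
Hypotheses (iP : i \in P) (jP : j \in P).
Hypotheses (nji : ~~ (v j <= v i)%MS) (oij : ~~ even_line i j).
Hypotheses (zP : z \in P) (nzi : ~~ (v z <= v i)%MS) (eiz : even_line i z).

Let nij : ~~ (v i <= v j)%MS. Proof. by rewrite parC ?inS. Qed.

Let niz : ~~ (v i <= v z)%MS. Proof. by rewrite parC ?inS. Qed.

Let on_odd_line_i : on_odd_line i.
Proof. by apply/on_odd_lineP; exists j. Qed.

Let on_odd_line_j : on_odd_line j.
Proof. by apply/on_odd_lineP; exists i; rewrite // even_lineC. Qed.

Let apex_even_line x : x \in P -> ~~ (v x <= v z)%MS -> even_line z x.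
Proof.
apply: not_on_odd_line_even.
exact: even_neighbour_not_on_odd_line on_odd_line_i iP zP nzi eiz.
Qed.

Lemma apex_off_odd_line x y : x \in P -> ~~ (v x <= v z)%MS -> ~~ even_line x y ->
  ~~ (v z <= v x + v y)%MS.
Proof.
move=> xP nxz; apply: contraNN => zxy; have nzx : ~~ (v z <= v x)%MS by rewrite parC ?inS.
by rewrite -(even_line_eq S zxy nzx) even_lineC; apply: apex_even_line.
Qed.

Let nz_ij : ~~ (v z <= v i + v j)%MS. Proof. exact: apex_off_odd_line. Qed.

Let njz : ~~ (v j <= v z)%MS.
Proof. by rewrite parC ?inS //; apply: contraNN nz_ij => /submx_addsr->. Qed.

Lemma off_apex_on_odd_line a : a \in P -> ~~ (v a <= v z)%MS -> on_odd_line a.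
Proof.
move=> aP naz; apply: contraT => nodda.
have through_apex x : x \in P -> on_odd_line x -> ~~ (v x <= v z)%MS ->
    (v a <= v x + v z)%MS.
  move=> xP oddx nxz; have nax : ~~ (v a <= v x)%MS.
    apply: contraNN nodda => ax.
    by rewrite (simple_parallel (on_odd_line_simple xP oddx) (inS xP) (inS aP) ax).
  have nzx : ~~ (v z <= v x)%MS by rewrite parC ?inS.
  apply: (on_odd_line_even_line_unique oddx xP zP aP nzx nax); rewrite even_lineC.
    exact: apex_even_line.
  by rewrite (not_on_odd_line_even nodda xP) // parC ?inS.
have azi : (v a <= v z + v i)%MS by rewrite addsmxC through_apex.
have azj : (v a <= v z + v j)%MS by rewrite addsmxC through_apex.
have nizj : ~~ (v i <= v z + v j)%MS.
  apply: contraNN nz_ij; rewrite addsmxC => ijz.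
  by rewrite addsmxC addsmx_exchange.
by rewrite (addsmx_modular (addsmxSl _ _) azi azj nizj) in naz.
Qed.

Lemma off_apex_odd_line a b : a \in P -> b \in P -> ~~ (v a <= v z)%MS ->
  ~~ (v b <= v z)%MS -> ~~ (v b <= v a)%MS -> ~~ even_line a b.
Proof.
move=> aP bP naz nbz nba; apply/negP => eab.
have := even_neighbour_not_on_odd_line (off_apex_on_odd_line aP naz) aP bP nba eab.
by rewrite off_apex_on_odd_line.
Qed.

Lemma apex_simple : simple z.
Proof.
have [iS zS] := (inS iP, inS zP).
have iz : flat S (v i + v z)%MS = i |: flat S (v z).
  apply/setP=> k; rewrite in_setU1 !in_flat.
  apply/andP/orP => [[kS kiz]|[/eqP->|/andP[kS kz]]]; last 2 first.
  - by rewrite iS addsmxSl.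
  - by rewrite kS submx_addsr.
  have kP : k \in P by rewrite in_flat kS (submx_trans kiz) // addsmx_sub !inM.
  have [kz|nkz] := boolP (v k <= v z)%MS; [by right; rewrite kS | left].
  apply/eqP/(simple_parallel (on_odd_line_simple iP on_odd_line_i)) => //.
  apply: contraT => nki.
  by have := off_apex_odd_line iP kP niz nkz nki; rewrite (even_line_eq S kiz nki) eiz.
have := multiplicity_le afS bS zS; have := multiplicity_gt0 v zS.
move: eiz; rewrite /even_line iz cardsU1 in_flat iS (negbTE niz) -/(multiplicity v S z).
by case: multiplicity => [|[|[]]].
Qed.

Lemma off_apex_collinear : (conf_span (P :\ z) <= v i + v j)%MS.
Proof.
have offz l : l \in P :\ z -> l \in P /\ ~~ (v l <= v z)%MS.
  rewrite in_setD1 => /andP[neq_lz lP]; split=> //; apply: contraNN neq_lz => lz.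
  exact/eqP/(simple_parallel apex_simple (inS zP) (inS lP)).
have inD1 l : l \in P -> ~~ (v l <= v z)%MS -> l \in P :\ z.
  by move=> lP nlz; rewrite in_setD1 lP andbT; apply: contraNneq nlz => ->.
have sDS : P :\ z \subset S by apply/subsetP=> l /offz[/inS].
apply: (odd_lines_collinear afS bS sDS (inD1 i iP niz) (inD1 j jP njz) nji) => y l.
rewrite in_set2 => yij /offz[lP nlz] nlij.
have [yP nyz nly] : [/\ y \in P, ~~ (v y <= v z)%MS & ~~ (v l <= v y)%MS].
  case/orP: yij => /eqP->; split=> //; apply: contraNN nlij; first exact: submx_addsl.
  exact: submx_addsr.
have oyl := off_apex_odd_line yP lP nyz nlz nly; split; first by move: oyl; rewrite negbK.
apply/subsetP=> k; rewrite in_flat => /andP[kS kyl].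
have kP : k \in P by rewrite in_flat kS (submx_trans kyl) // addsmx_sub !inM.
rewrite in_setD1 kP andbT.
by apply: contraNneq (apex_off_odd_line yP nyz oyl) => <-.
Qed.

End Plane.

Lemma skew_lines_disjoint i j x y z : x \in S -> z \in S ->
  ~~ (v x <= v i + v j)%MS -> ~~ (v y <= v i + v j + v x)%MS ->
  (v z <= v x + v y)%MS -> ~~ (v z <= v i + v j)%MS.
Proof.
move=> xS zS nx ny zxy; apply: contraNN nx => zij.
have zx : (v z <= v x)%MS.
  by apply: addsmx_modular (addsmxSr _ _) zxy _ ny; apply: submx_addsl.
by apply: submx_trans zij; rewrite parC.
Qed.

Definition spans_odd_line i j :=
  [&& i \in S, j \in S, ~~ (v j <= v i)%MS & ~~ even_line i j].

Lemma spans_odd_lineC i j : spans_odd_line i j -> spans_odd_line j i.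
Proof.
case/and4P=> iS jS nji oij; apply/and4P; split=> //; first by rewrite parC.
by rewrite even_lineC.
Qed.

Section OffOddLine.
Variables (i j : T).
Hypothesis odd_ij : spans_odd_line i j.

Let iS : i \in S. Proof. by case/and4P: odd_ij. Qed.
Let jS : j \in S. Proof. by case/and4P: odd_ij. Qed.
Let nji : ~~ (v j <= v i)%MS. Proof. by case/and4P: odd_ij. Qed.
Let oij : ~~ even_line i j. Proof. by case/and4P: odd_ij. Qed.

Lemma exists_even_line_over_odd_line w (P := flat S (v i + v j + v w)%MS) :
  w \in S -> ~~ (v w <= v i + v j)%MS ->
  exists2 z, z \in P & ~~ (v z <= v i)%MS /\ even_line i z.
Proof.
move=> wS nw; have [iP _ _] := flat_plane v iS jS wS.
apply: exists_even_line_in_flat iP (odd_line_simple iS oij).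
exact: rank_conf_span_plane nw.
Qed.

Lemma plane_over_odd_line w k : w \in S -> k \in S -> ~~ (v w <= v i + v j)%MS ->
  (v k <= v i + v j + v w)%MS -> k != w -> (v k <= v i + v j)%MS.
Proof.
move=> wS kS nw kM neq_kw; have [iM jM wM] := flat_plane v iS jS wS.
have rank_M := rank_plane (antipodal_free_neq0 afS iS) nji nw.
have span_M : (v i + v j + v w <= conf_span (flat S (v i + v j + v w)%MS))%MS.
  by rewrite !addsmx_sub !mem_conf_span.
have [z zM [nzi eiz]] := exists_even_line_over_odd_line wS nw.
have /sub_conf_spanP sub := off_apex_collinear rank_M span_M iM jM nji oij zM nzi eiz.
have zw : z = w.
  by apply/eqP; apply: contraNT nw => neq_zw; apply: sub; rewrite in_setD1 eq_sym neq_zw.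
by apply: sub; rewrite zw in_setD1 neq_kw in_flat kS.
Qed.

Lemma even_line_off_odd_line w : w \in S -> ~~ (v w <= v i + v j)%MS -> even_line i w.
Proof.
move=> wS nw; have [z] := exists_even_line_over_odd_line wS nw.
rewrite in_flat => /andP[zS zM] [nzi eiz]; have [<- //|neq_zw] := eqVneq z w.
have zij := plane_over_odd_line wS zS nw zM neq_zw.
by rewrite (even_line_eq S zij nzi) (negbTE oij) in eiz.
Qed.

Lemma simple_off_odd_line w : w \in S -> ~~ (v w <= v i + v j)%MS -> simple w.
Proof.
move=> wS nw; apply/multiplicity1P => //; apply/setP=> k; rewrite in_flat in_set1.
apply/andP/eqP => [[kS kw]|->]; last by rewrite wS.
apply: contraNeq (nw) => neq_kw; have wk : (v w <= v k)%MS by rewrite parC.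
exact: submx_trans wk (plane_over_odd_line wS kS nw (submx_addsr _ kw) neq_kw).
Qed.

End OffOddLine.

Lemma odd_lines_off_odd_line i j w x : spans_odd_line i j -> w \in S -> x \in S ->
  ~~ (v w <= v i + v j)%MS -> ~~ (v x <= v i + v j)%MS -> ~~ (v x <= v w)%MS ->
  ~~ (v x <= v i + v j + v w)%MS /\ spans_odd_line w x.
Proof.
move=> odd_ij wS xS nw nx nxw; have /and4P[iS jS nji _] := odd_ij.
have nxM : ~~ (v x <= v i + v j + v w)%MS.
  apply: contraNN nx => xM; apply: (plane_over_odd_line odd_ij wS xS nw xM).
  by apply: contraNneq nxw => ->.
split=> //; apply/and4P; split=> //; apply: contraNN nxM => ewx.
have ewi : even_line w i by rewrite even_lineC (even_line_off_odd_line odd_ij).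
have ewj : even_line w j.
  by rewrite even_lineC (even_line_off_odd_line (spans_odd_lineC odd_ij)) 1?addsmxC.
have sw := simple_off_odd_line odd_ij wS nw.
rewrite addsmxC addsmxA; apply: (even_lines_coplanar afS bS wS sw xS) => //.
  by rewrite parC //; apply: contraNN nw => /submx_addsl->.
by apply: contraNN nw; rewrite addsmxC => /addsmx_exchange->.
Qed.

Lemma off_odd_line_collinear i j k l : spans_odd_line i j -> k \in S -> l \in S ->
  ~~ (v k <= v i + v j)%MS -> ~~ (v l <= v i + v j)%MS -> ~~ (v l <= v k)%MS ->
  (conf_span [set x in S | ~~ (v x <= v i + v j)%MS] <= v k + v l)%MS.
Proof.
move=> odd_ij kS lS nk nl nlk; set W := [set _ in S | _].
have sWS : W \subset S by apply/subsetP=> x; rewrite inE => /andP[].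
have [kW lW] : k \in W /\ l \in W by rewrite !inE kS lS nk nl.
apply: (odd_lines_collinear afS bS sWS kW lW nlk) => y x.
rewrite in_set2 !inE => ykl /andP[xS nx] nxkl.
have [yS ny nxy] : [/\ y \in S, ~~ (v y <= v i + v j)%MS & ~~ (v x <= v y)%MS].
  case/orP: ykl => /eqP->; split=> //; apply: contraNN nxkl; first exact: submx_addsl.
  exact: submx_addsr.
have [nxM /and4P[_ _ _]] := odd_lines_off_odd_line odd_ij yS xS ny nx nxy.
rewrite negbK => odd_yx; split=> //.
apply/subsetP=> z; rewrite in_flat inE => /andP[zS zyx]; rewrite zS /=.
exact: skew_lines_disjoint yS zS ny nxM zyx.
Qed.

Lemma exists_odd_line i : i \in S -> simple i -> exists j, spans_odd_line i j.
Proof.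
move=> iS si; apply/existsP; apply: contraT; rewrite negb_exists => /forallP none.
have even l : l \in S -> ~~ (v l <= v i)%MS -> even_line i l.
  by move=> lS nli; have := none l; rewrite /spans_odd_line iS lS nli negbK.
have [p pS] := exists_notin_line (v i) 0 (ltnW rank_gt3); rewrite addsmx0 => npi.
have [q qS nqip] := exists_notin_line (v i) (v p) (ltnW rank_gt3).
have [r rS nr] := exists_notin_plane (v i) (v p) (v q) rank_gt3.
case/negP: (nr); apply: (even_lines_coplanar afS bS iS si rS npi nqip); apply: even => //.
  by apply: contraNN nqip => /submx_addsl->.
by apply: contraNN nr; rewrite -addsmxA => /submx_addsl->.
Qed.

Theorem two_odd_lines : exists i j k l,
  let A := flat S (v i + v j)%MS in let B := flat S (v k + v l)%MS in
  [/\ spans_odd_line i j, spans_odd_line k l, A :|: B = S & [disjoint A & B]].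
Proof.
have [i iS si] := exists_simple_point afS bS (ltnW rank_gt3).
have [j odd_ij] := exists_odd_line iS si.
have [k kS nk] := exists_notin_line (v i) (v j) (ltnW rank_gt3).
have [l lS nlM] := exists_notin_plane (v i) (v j) (v k) rank_gt3.
have nl : ~~ (v l <= v i + v j)%MS by apply: contraNN nlM => /submx_addsl->.
have nlk : ~~ (v l <= v k)%MS by apply: contraNN nlM => /submx_addsr->.
have [_ odd_kl] := odd_lines_off_odd_line odd_ij kS lS nk nl nlk.
have /sub_conf_spanP off_ij := off_odd_line_collinear odd_ij kS lS nk nl nlk.
exists i, j, k, l => A B; split=> //.
  apply/setP=> x; rewrite in_setU !in_flat; have [xS|//] := boolP (x \in S).
  by have [//|nx] := boolP (v x <= v i + v j)%MS; rewrite off_ij // inE xS nx.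
rewrite -setI_eq0; apply/eqP/setP=> x; rewrite in_setI !in_flat in_set0.
apply/negP=> /andP[/andP[xS xij] /andP[_ xkl]].
by have /negP := skew_lines_disjoint kS xS nk nlM xkl.
Qed.

End TwoOddLines.

Section Discrepancy.
Variables (R : realType) (N n : nat) (V : 'M[R]_(N, n)).
Hypotheses (n_gt0 : (0 < n)%N) (rows_neq0 : forall i : 'I_N, row i V != 0).
Implicit Types (S A B : {set 'I_N}) (u : 'cV[R]_n) (i : 'I_N).

Local Notation v := (fun i : 'I_N => row i V).
Local Notation sign_sum := (sign_sum v).
Local Notation bounded S D := (sign_bounded v S (0 : 'M_n) D).
Local Notation codeg := (codeg_star V).
Local Notation DD := (DD V).

Lemma sign_sum_pos_neg S u : sign_sum S u = (pos_count V S u)%:Z - (neg_count V S u)%:Z.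
Proof.
have cardE (P : pred 'I_N) : #|[set i in S | P i]|%:Z = \sum_(i in S) (P i)%:Z.
  rewrite -[LHS]natz -sumr_const [RHS]big_mkcond [LHS]big_mkcond /=.
  by apply: eq_bigr => i _; rewrite inE; case: (i \in S); case: (P i).
rewrite /pos_count /neg_count !cardE -sumrB; apply: eq_bigr => i _.
rewrite -[fval V u i]/(lform u (row i V)).
case: (ltrgt0P (lform u (row i V))) => [s|s|->]; last by rewrite sgz0.
  by rewrite gtr0_sgz.
by rewrite ltr0_sgz.
Qed.

Lemma disc_sign_sum S u : disc V S u = `|sign_sum S u|%N.
Proof. by rewrite sign_sum_pos_neg. Qed.

Lemma bounded_DD S : bounded S (DD S).
Proof.
move=> u _; rewrite -disc_sign_sum /Defs.DD; case: ex_maxnP => D _ max; apply: max.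
by apply/asboolP; exists u.
Qed.

Lemma DD_attained S : exists u, sign_sum S u = DD S.
Proof.
have [u uS] : exists u, `|sign_sum S u|%N = DD S.
  rewrite /Defs.DD; case: ex_maxnP => D /asboolP[u <-] _.
  by exists u; rewrite disc_sign_sum.
case sumE: (sign_sum S u) uS => [d|d] /= <-; first by exists u.
by exists (- u); rewrite sign_sumN sumE NegzE opprK.
Qed.

Lemma DD_le S D : bounded S D -> (DD S <= D)%N.
Proof.
move=> bS; have [u uS] := DD_attained S.
by have := bS u (sub0mx _ _); rewrite uS.
Qed.

Lemma eq_DD A B : sign_sum A =1 sign_sum B -> DD A = DD B.
Proof.
move=> eqAB; apply/eqP; rewrite eqn_leq; apply/andP.
by split; apply: DD_le => u u0; [rewrite eqAB | rewrite -eqAB]; apply: bounded_DD.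
Qed.

Lemma exists_generic_maximal_form S : exists u,
  [/\ u != 0, forall i, lform u (row i V) != 0 & sign_sum S u = DD S].
Proof.
have [w wS] := DD_attained S.
(* The vector at [None] makes [u] nonzero even when [V] has no rows. *)
pose x o := if o is Some i then row i V else const_mx 1.
have x_neq0 o : x o != 0.
  case: o => [i|] /=; first exact: rows_neq0.
  by apply/eqP => /rowP/(_ (Ordinal n_gt0)) /eqP; rewrite !mxE oner_eq0.
have [g _ gen_g] := exists_generic_form x (0 : 'M[R]_n).
have [e _ pert] := exists_perturbation x w g; pose u := w + e *: g.
have u_neq0 o : lform u (x o) != 0.
  rewrite -sgz_eq0 pert; case: ifPn; rewrite sgz_eq0 // => _.
  by apply: gen_g; rewrite submx0.
exists u; split=> [|i|]; last 1 first.
- have := sign_bounded_contraction (@bounded_DD S) (sub0mx n (kermx w)) (submx_refl _)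
    (sub0mx n (kermx g)).
  rewrite wS => le_DD; have flat0 : sign_sum (flat v S (kermx w)) g = 0.
    by apply/eqP; rewrite -absz_eq0 -leqn0 -(leq_add2l (DD S)) addn0.
  rewrite -wS -[RHS]addr0 -flat0 sign_sum_flat -big_split; apply: eq_bigr => i _ /=.
  rewrite (pert (Some i)) -lform_eq0; case: eqP => [->|_]; last by rewrite addr0.
  by rewrite sgz0 add0r.
- by apply: contraNneq (u_neq0 None) => ->; rewrite lform0.
- exact: (u_neq0 (Some i)).
Qed.

Lemma pos_nneg_count S u : (pos_count V S u + nneg_count V S u)%N = #|S|.
Proof.
rewrite -(cardsID [set i | 0 < fval V u i] S); congr addn; apply: eq_card => i.
  by rewrite !inE.
by rewrite !inE leNgt andbC.
Qed.

Lemma neg_le_nneg_count S u : (neg_count V S u <= nneg_count V S u)%N.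
Proof. by apply/subset_leq_card/subsetP=> i; rewrite !inE => /andP[-> /ltW]. Qed.

Lemma codeg_star_le S u : u != 0 -> (codeg S <= nneg_count V S u)%N.
Proof.
move=> u_neq0.
have attained : `[< exists u', u' != 0 /\ nneg_count V S u' = nneg_count V S u >].
  by apply/asboolP; exists u.
rewrite /codeg_star; case: pselect => [ex|[]]; last by exists (nneg_count V S u).
by case: ex_minnP => c _; apply.
Qed.

Lemma codeg_star_attained S : exists2 u, u != 0 & nneg_count V S u = codeg S.
Proof.
have [u [u_neq0 _ _]] := exists_generic_maximal_form S.
rewrite /codeg_star; case: pselect => [ex|[]]; last first.
  by exists (nneg_count V S u); apply/asboolP; exists u.
by case: ex_minnP => c /asboolP[w [w_neq0 <-]] _; exists w.
Qed.

Lemma codeg_star_card S : (2 * codeg S + DD S)%N = #|S|.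
Proof.
have [u [u_neq0 gen_u uS]] := exists_generic_maximal_form S.
have neg_u : neg_count V S u = nneg_count V S u.
  by apply: eq_card => i; rewrite !inE lt_neqAle [fval _ _ _ == 0](negbTE (gen_u i)).
have [w w_neq0 wS] := codeg_star_attained S.
have := codeg_star_le S u_neq0; have := bounded_DD S (sub0mx n (kermx w)).
have := pos_nneg_count S u; have := pos_nneg_count S w; have := neg_le_nneg_count S w.
move: uS; rewrite !sign_sum_pos_neg neg_u wS; clear; lia.
Qed.

End Discrepancy.

Section Decomposition.
Variables (R : realType) (N n : nat) (V : 'M[R]_(N, n)).
Hypotheses (n_gt0 : (0 < n)%N) (rows_neq0 : forall i : 'I_N, row i V != 0).
Implicit Types (S A B : {set 'I_N}) (u : 'cV[R]_n) (i j k l : 'I_N).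
Implicit Types ps : seq {set 'I_N}.

Local Notation v := (fun i : 'I_N => row i V).
Local Notation sign_sum := (sign_sum v).
Local Notation codeg := (codeg_star V).
Local Notation DD := (DD V).
Local Notation conf_span := (conf_span v).
Local Notation cardE := (codeg_star_card n_gt0 rows_neq0).

Definition decomposes S ps :=
  [/\ pairwise (fun A B => [disjoint A & B]) ps, all (fun A : {set 'I_N} => A \subset S) ps,
      all (fun A => 0 < codeg A)%N ps, codeg S = (\sum_(A <- ps) codeg A)%N
    & (\rank (conf_span S) <= size ps + DD S)%N].

Lemma decomposes_nil S : codeg S = 0%N -> decomposes S [::].
Proof.
move=> codeg0; split=> //; first by rewrite big_nil.
by apply: leq_trans (rank_conf_span_le_card v S) _; rewrite -cardE codeg0.
Qed.

Lemma decomposes_self S :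
  (0 < codeg S)%N -> (\rank (conf_span S) <= 1 + DD S)%N -> decomposes S [:: S].
Proof. by move=> codeg_gt0 rk; split; rewrite ?big_seq1 //= ?codeg_gt0 ?subxx. Qed.

Lemma rank_conf_span_DD_le1 S :
  antipodal_free v S -> (DD S <= 1)%N -> (\rank (conf_span S) <= 1 + DD S)%N.
Proof.
move=> afS; have bS := @bounded_DD _ _ _ V S.
rewrite leq_eqVlt ltnS leqn0 => /orP[]/eqP DD_S.
  by rewrite DD_S; apply: (rank_conf_span_bounded1 afS); rewrite -DD_S.
suff -> : S = set0 by rewrite /conf_span big_set0 mxrank0.
apply/eqP/set0Pn => -[i iS]; have := multiplicity_le afS bS iS.
by rewrite DD_S leqNgt multiplicity_gt0.
Qed.

Lemma codeg_star_odd_line S i j (A : {set 'I_N} := flat v S (v i + v j)%MS) :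
  antipodal_free v S -> (DD S <= 2)%N -> spans_odd_line v S i j ->
  (0 < codeg A)%N /\ (2 * codeg A + 1)%N = #|A|.
Proof.
move=> afS DD_S /and4P[iS jS nji]; rewrite negbK -/A => oddA.
have bA : sign_bounded v A (0 : 'M_n) 2.
  by apply: bounded_flat => u u0; apply: leq_trans DD_S; apply: bounded_DD.
have afA : antipodal_free v A := antipodal_freeS (flat_subset _ _ _) afS.
have DD_A : (DD A <= 1)%N := DD_le (odd_bounded1 afA bA oddA).
have [iA jA] := flat_line v iS jS; have : (1 < #|A|)%N.
  by apply/card_gt1P; exists i, j; split=> //; apply: contraNneq nji => ->.
by move: oddA DD_A; rewrite -(cardE A); clear; lia.
Qed.

Lemma decomposes_two_odd_lines S : antipodal_free v S -> DD S = 2%N ->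
  (3 < \rank (conf_span S))%N -> exists ps, decomposes S ps.
Proof.
move=> afS DD_S rk; have bS : sign_bounded v S (0 : 'M_n) 2.
  by rewrite -DD_S; apply: bounded_DD.
have [i [j [k [l /= [oij okl AB_S dAB]]]]] := two_odd_lines afS bS rk.
have DD_le2 : (DD S <= 2)%N by rewrite DD_S.
have [codeg_A card_A] := codeg_star_odd_line afS DD_le2 oij.
have [codeg_B card_B] := codeg_star_odd_line afS DD_le2 okl.
exists [:: flat v S (v i + v j)%MS; flat v S (v k + v l)%MS]; split.
- by rewrite /= dAB.
- by rewrite /= !flat_subset.
- by rewrite /= codeg_A codeg_B.
- have := cardE S; rewrite -[in RHS]AB_S cardsU disjoint_setI0 // cards0 subn0.
  by rewrite -card_A -card_B DD_S big_cons big_seq1; clear; lia.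
rewrite DD_S; apply: leq_trans (_ : \rank (v i + v j + v k + v l)%MS <= 4)%N.
  apply/mxrankS/sub_conf_spanP => x; rewrite -[in X in X -> _]AB_S in_setU !in_flat.
  case/orP=> /andP[_ xL]; apply: submx_trans xL _; first by rewrite -addsmxA addsmxSl.
  by rewrite -!addsmxA (addsmxA (v i)) addsmxSr.
by apply: leq_trans (rank_adds_rV_le _ _) _; rewrite ltnS rank_plane_le.
Qed.

Lemma antipodal_free_decomposes S : antipodal_free v S -> (DD S <= 2)%N ->
  exists ps, decomposes S ps.
Proof.
move=> afS DD_S; have [codeg0|codeg_gt0] := posnP (codeg S).
  by exists [::]; apply: decomposes_nil.
have [rk|rk] := leqP (\rank (conf_span S)) (1 + DD S).
  by exists [:: S]; apply: decomposes_self.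
have DD2 : DD S = 2%N.
  apply/eqP; rewrite eqn_leq DD_S ltnNge; apply: contraTN rk; rewrite -leqNgt.
  exact: rank_conf_span_DD_le1.
by apply: decomposes_two_odd_lines => //; rewrite DD2 in rk.
Qed.

Section AntipodalPair.
Variables (S : {set 'I_N}) (i j : 'I_N) (c : R).
Hypotheses (iS : i \in S) (jS : j \in S) (c_lt0 : c < 0) (row_j : row j V = c *: row i V).

Lemma antipodal_neq : i != j.
Proof.
apply/eqP=> ij; move/eqP: row_j; rewrite -ij -subr_eq0 -[X in X - _]scale1r -scalerBl.
by rewrite scaler_eq0 subr_eq0 (negbTE (rows_neq0 i)) orbF gt_eqF // (lt_trans c_lt0).
Qed.

Let pair_sub : [set i; j] \subset S.
Proof. by rewrite subUset !sub1set iS. Qed.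

Lemma sign_sum_antipodal u : sign_sum [set i; j] u = 0.
Proof.
rewrite /sign_sum big_setU1 ?big_set1 ?inE ?antipodal_neq //=.
by rewrite row_j scalarZ sgzM (ltr0_sgz c_lt0) mulN1r subrr.
Qed.

Lemma DD_antipodalD : DD (S :\: [set i; j]) = DD S.
Proof.
apply: eq_DD => u; rewrite [RHS](big_setID [set i; j]) (setIidPr pair_sub) /=.
by rewrite -[X in _ = X + _]/(sign_sum _ u) sign_sum_antipodal add0r.
Qed.

Lemma codeg_star_antipodal : codeg [set i; j] = 1%N.
Proof.
have DD0 : DD [set i; j] = 0%N.
  by apply/eqP; rewrite -leqn0; apply: DD_le => u _; rewrite sign_sum_antipodal.
by have := cardE [set i; j]; rewrite cards2 antipodal_neq DD0; lia.
Qed.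

Lemma card_antipodalD : #|S| = (#|S :\: [set i; j]| + 2)%N.
Proof.
by rewrite -(cardsID [set i; j] S) (setIidPr pair_sub) cards2 antipodal_neq addnC.
Qed.

Lemma decomposes_antipodal ps :
  decomposes (S :\: [set i; j]) ps -> decomposes S ([set i; j] :: ps).
Proof.
case=> disj sub pos sum rk; split.
- rewrite /= disj andbT; apply/allP => A /(allP sub) sA.
  rewrite disjoint_sym; apply: disjointWl sA _.
  by rewrite -setI_eq0 setIDAC setDIl setDv setI0.
- rewrite /= pair_sub; apply/allP => A /(allP sub) sA.
  exact: subset_trans sA (subsetDl _ _).
- by rewrite /= codeg_star_antipodal.
- rewrite big_cons -sum codeg_star_antipodal.
  have := cardE S; have := cardE (S :\: [set i; j]).
  by rewrite DD_antipodalD card_antipodalD; clear; lia.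
rewrite DD_antipodalD in rk; rewrite /= addSn.
apply: (@leq_trans (\rank (conf_span (S :\: [set i; j]))).+1); last by rewrite ltnS.
apply: (rank_conf_span_leD1 (x := row i V)) => k kS.
rewrite !inE kS andbT negb_or; case: eqP => [->|_]; first by right.
by case: eqP => [->|_]; [right; rewrite row_j scalemx_sub | left].
Qed.

End AntipodalPair.

Theorem exists_decomposes S : (DD S <= 2)%N -> exists ps, decomposes S ps.
Proof.
have [m] := ubnP #|S|; elim: m S => // m IH S card_S DD_S.
have [afS|] := pselect (antipodal_free v S); first exact: antipodal_free_decomposes.
move=> /existsNP[i] /existsNP[j] /existsNP[c] /not_implyP[iS] /not_implyP[jS].
move=> /not_implyP[/= row_j /negP]; rewrite -leNgt le_eqVlt => /orP[/eqP c0|c_lt0].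
  by have := rows_neq0 j; rewrite row_j c0 scale0r eqxx.
have [||ps dec] := IH (S :\: [set i; j]).
- by move: card_S; rewrite (card_antipodalD iS jS c_lt0 row_j); lia.
- by rewrite (DD_antipodalD iS jS c_lt0 row_j).
by exists ([set i; j] :: ps); exact: (decomposes_antipodal iS jS c_lt0 row_j dec).
Qed.

End Decomposition.

Section Partition.
Variables (R : realType) (N n : nat) (V : 'M[R]_(N, n)).

Lemma codeg_decomposition_of_seq (ps : seq {set 'I_N}) :
  pairwise (fun A B : {set 'I_N} => [disjoint A & B]) ps ->
  all (fun A => 0 < codeg_star V A)%N ps ->
  codeg_star V setT = (\sum_(A <- ps) codeg_star V A)%N ->
  exists c : 'I_N -> option 'I_(size ps), codeg_decomposition V c.
Proof.
move=> disj pos sum; pose c i := [pick j : 'I_(size ps) | i \in nth set0 ps j].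
have disj_lt (j k : 'I_(size ps)) : (j < k)%N -> [disjoint nth set0 ps j & nth set0 ps k].
  by move=> ltjk; apply: (pairwiseP set0 disj) => //; rewrite inE ltn_ord.
have uniq_part i (j k : 'I_(size ps)) :
    i \in nth set0 ps j -> i \in nth set0 ps k -> j = k.
  move=> ij ik; apply/val_inj; case: (ltngtP j k) => // [/disj_lt|/disj_lt] djk.
    by rewrite (disjointFr djk ij) in ik.
  by rewrite (disjointFr djk ik) in ij.
have partE j : part c j = nth set0 ps j.
  apply/setP=> i; rewrite inE /c; case: pickP => [k ik|none]; last by rewrite none.
  by apply/eqP/idP => [[<-] //|ij]; rewrite (uniq_part i k j).
exists c; split=> [|j]; last by rewrite partE; apply: (allP pos); rewrite mem_nth.
by rewrite sum (big_nth set0) big_mkord; apply: eq_bigr => j _; rewrite partE.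
Qed.

End Partition.

Lemma codeg_star_dim0 (R : realType) (N : nat) (V : 'M[R]_(N, 0)) (S : {set 'I_N}) :
  codeg_star V S = 0%N.
Proof.
rewrite /codeg_star; case: pselect => // ex; case: (ex) => k /asboolP[u [/eqP[]]].
exact: flatmx0.
Qed.

Theorem mainTheorem2 (R : realType) (N n : nat) (V : 'M[R]_(N, n)) :
  (forall i : 'I_N, row i V != 0) ->
  (DD V setT <= 2)%N ->
  exists (m : nat) (c : 'I_N -> option 'I_m),
    (\rank V - DD V setT <= m)%N /\ codeg_decomposition V c.
Proof.
move=> rows_neq0 DD_le2; have [n0|n_gt0] := posnP n.
  subst n; exists 0%N, (fun=> None); split.
    by rewrite (leq_trans (leq_subr _ _)) ?rank_leq_col.
  by split=> [|[]//]; rewrite codeg_star_dim0 big_ord0.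
have [ps [disj _ pos sum rk]] := exists_decomposes n_gt0 rows_neq0 DD_le2.
have [c dec] := codeg_decomposition_of_seq disj pos sum.
exists (size ps), c; split=> //; rewrite leq_subLR addnC; apply: leq_trans rk.
by apply/mxrankS/row_subP => i; apply: (mem_conf_span (fun i => row i V)).
Qed.
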